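(* Let $\tau=142536$. Then $$\mathrm{NM}_\tau(t,x,y)=\left(\frac{1}{U_\tau(t,y)}\right)^x,\qquad U_\tau(t,y)=1+\sum_{n\ge 1}U_{\tau,n}(y)\frac{t^n}{n!},$$ where the polynomials $U_{\tau,n}(y)$ are given by $U_{\tau,1}(y)=-y$ and, for $n\ge 2$, $$U_{\tau,n}(y)=(1-y)U_{\tau,n-1}(y)+\sum_{k=0}^{\lfloor (n-8)/6\rfloor}\det(M_{k+1})\,y^{3k+3}\,U_{\tau,n-6k-7}(y)-\sum_{k=0}^{\lfloor (n-6)/6\rfloor}\det(P_{k+1})\,y^{3k+2}\Big[U_{\tau,n-6k-4}(y)+y\,U_{\tau,n-6k-5}(y)\Big],$$ where a sum with negative upper limit is empty.
   Context: $S_n$ is the set of permutations $\sigma=\sigma_1\cdots\sigma_n$ of $\{1,\dots,n\}$, written in one-line notation. $\mathrm{des}(\sigma)=|\{i:\sigma_i>\sigma_{i+1}\}|$. An entry $\sigma_j$ is a left-to-right minimum of $\sigma$ if $\sigma_i>\sigma_j$ for all $i<j$; $\mathrm{LRmin}(\sigma)$ is the number of left-to-right minima of $\sigma$. For a sequence of distinct positive integers $a_1\cdots a_m$, its reduction $\mathrm{red}(a_1\cdots a_m)\in S_m$ is obtained by replacing the $i$-th smallest entry by $i$. For a permutation $\tau$, $\sigma$ has a $\tau$-match starting at position $i$ if $\mathrm{red}(\sigma_i\sigma_{i+1}\cdots\sigma_j)=\tau$ for some $j>i$ (a match occupies consecutive positions). $\mathcal{NM}_n(\tau)$ is the set of $\sigma\in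 S_n$ with no $\tau$-match. Define $$\mathrm{NM}_\tau(t,x,y)=\sum_{n\ge 0}\frac{t^n}{n!}\mathrm{NM}_{\tau,n}(x,y),\qquad \mathrm{NM}_{\tau,n}(x,y)=\sum_{\sigma\in\mathcal{NM}_n(\tau)}x^{\mathrm{LRmin}(\sigma)}y^{1+\mathrm{des}(\sigma)}\ (n\ge1),$$ with the $n=0$ term equal to $1$. All identities are between formal power series in $t$, and for a power series $F$ in $t$ with constant term $1$, $F^x=\exp(x\log F)$. Let $C_n=\frac{1}{n+1}\binom{2n}{n}$ be the $n$-th Catalan number. For $k\ge1$, $M_k$ is the $k\times k$ matrix with $(i,j)$ entry $C_{3(j-i)+2}$ if $j\ge i$, $-1$ if $j=i-1$, and $0$ if $j<i-1$ (so $C_2$ on the main diagonal, $C_{3d+2}$ on the $d$-th diagonal above it, $-1$ on the subdiagonal, $0$ below). $P_k$ is the $k\times k$ matrix obtained from $M_k$ by replacing each entry $C_m$ in the last column by $C_{m-1}$; thus its last column has $(i,k)$ entry $C_{3(k-i)+1}$ for $1\le i\le k$, except that the $-1$'s and $0$'s of $M_k$ are unchanged. In particular $M_1=(C_2)$ and $P_1=(C_1)$. *)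

(* Defs.v *)
From HB Require Import structures.
From mathcomp Require Import all_boot all_order all_algebra all_fingroup.

Set Implicit Arguments.
Unset Strict Implicit.
Unset Printing Implicit Defensive.

Import Order.TTheory GRing.Theory Num.Theory.

Local Open Scope ring_scope.

(** A formal power series in t is its coefficient sequence.  Inverse,
    logarithm, exponential and powers are composites [a(G)] with [G] without
    constant term; [G ^ m] then has no coefficient of degree < m, which is why
    cutting the sum at [m <= n] loses nothing. *)

Section FormalPowerSeries.
Variable R : comUnitRingType.
Implicit Types F G : nat -> R.

Definition fps_one : nat -> R := fun n => (n == 0%N)%:R.

Definition fps_mul F G : nat -> R :=
  fun n => \sum_(i < n.+1) F i * G (n - i)%N.

Definition fps_pow F (m : nat) : nat -> R := iter m (fps_mul F) fps_one.

(* Meaningful when G 0 = 0. *)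
Definition fps_comp (a : nat -> R) G : nat -> R :=
  fun n => \sum_(m < n.+1) a m * fps_pow G m n.

(* Meaningful when F 0 = 1; sum of (1 - F)^m over m >= 0. *)
Definition fps_inv F : nat -> R :=
  fps_comp (fun=> 1) (fun n => fps_one n - F n).

Lemma fps_pow_small G m n : G 0%N = 0 -> (n < m)%N -> fps_pow G m n = 0.
Proof.
move=> G0; elim: m n => // m IHm n ltnm; rewrite /= /fps_mul big1 // => -[[|i] lti] _.
  by rewrite G0 mul0r.
rewrite [fps_pow G m _]IHm ?mulr0 //.
case: n ltnm lti => // n ltnm lti.
by rewrite subSS (leq_ltn_trans (leq_subr i n)).
Qed.

Lemma fps_mulV F n : F 0%N = 1 -> fps_mul F (fps_inv F) n = fps_one n.
Proof.
move=> F0; pose G k := fps_one k - F k.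
have G0 : G 0%N = 0 by rewrite /G F0 /fps_one eqxx subrr.
have one_mul H : fps_mul fps_one H n = H n.
  rewrite /fps_mul big_ord_recl big1 ?addr0 ?subn0 ?mul1r // => i _.
  by rewrite /fps_one mul0r.
transitivity (\sum_(m < n.+1) (fps_pow G m n - fps_pow G m.+1 n)).
  transitivity (\sum_(m < n.+1) fps_mul F (fps_pow G m) n).
    rewrite exchange_big; apply: eq_bigr => i _; rewrite -mulr_sumr; congr (_ * _).
    rewrite /fps_inv /fps_comp -/G.
    rewrite (big_ord_widen n.+1 (fun m => 1 * fps_pow G m (n - i)%N)) ?ltnS ?leq_subr //.
    rewrite big_mkcond; apply: eq_bigr => m _; rewrite mul1r.
    by case: ltnP => // lt_m; rewrite fps_pow_small.
  apply: eq_bigr => m _ /=.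
  rewrite -[X in X - _]one_mul /fps_mul -sumrB; apply: eq_bigr => i _.
  by rewrite -mulrBl /G opprB addrC subrK.
rewrite -(big_mkord xpredT (fun m => fps_pow G m n - fps_pow G m.+1 n)).
rewrite (telescope_sumr_eq (fun m => - fps_pow G m n)) // => [|m _].
  by rewrite fps_pow_small // oppr0 opprK add0r.
by rewrite opprK addrC.
Qed.

(* Meaningful when F 0 = 1; sum of (-1)^(m-1) (F - 1)^m / m over m >= 1. *)
Definition fps_log F : nat -> R :=
  fps_comp (fun m => if m is m'.+1 then (-1) ^+ m' / m'.+1%:R else 0)
           (fun n => F n - fps_one n).

(* Meaningful when G 0 = 0. *)
Definition fps_exp G : nat -> R := fps_comp (fun m => (m`!%:R)^-1) G.

Definition fps_rpow F (x : R) : nat -> R :=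
  fps_exp (fun n => x * fps_log F n).

Definition egf (a : nat -> R) : nat -> R := fun n => a n / n`!%:R.

End FormalPowerSeries.

(** Q[x,y]: the outer variable is x and the inner one is y, so a polynomial in
    y alone is a constant [p%:P]. *)
Notation Qxy := {poly {poly rat}}.
Definition xvar : Qxy := 'X.
Definition yvar : Qxy := 'X%:P.

(* The divisions in [fps_log], [fps_exp] and [egf] over Q[x,y] are genuine. *)
Lemma Qxy_natr_unit (m : nat) : (m.+1%:R : Qxy) \is a GRing.unit.
Proof.
rewrite -(rmorph_nat (polyC : {poly rat} -> Qxy)) rmorph_unit //.
by rewrite -(rmorph_nat (polyC : rat -> {poly rat})) rmorph_unit // unitfE pnatr_eq0.
Qed.

(** Permutations of {0,...,n-1}; [word] shifts values to {1,...,n}. *)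

Definition word n (s : 'S_n) : seq nat := [seq (s i : nat).+1 | i <- enum 'I_n].

Definition des n (s : 'S_n) : nat :=
  #|[set i : 'I_n | [exists j : 'I_n, (j == i.+1 :> nat) && (s j < s i)%N]]|.

Definition LRmin n (s : 'S_n) : nat :=
  #|[set j : 'I_n | [forall i : 'I_n, (i < j)%N ==> (s j < s i)%N]]|.

Definition red (w : seq nat) : seq nat :=
  [seq (index a (sort leq w)).+1 | a <- w].

(* Positions are counted from 0, and [j] is the last position of the match. *)
Definition match_at (tau w : seq nat) (i : nat) : bool :=
  [exists j : 'I_(size w),
     (i < j)%N && (red (take (j.+1 - i) (drop i w)) == tau)].

Definition NM_set (tau : seq nat) (n : nat) : {set 'S_n} :=
  [set s : 'S_n | ~~ [exists i : 'I_n, match_at tau (word s) i]].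

Definition NM_poly (tau : seq nat) (n : nat) : Qxy :=
  if n is 0 then 1
  else \sum_(s in NM_set tau n) xvar ^+ LRmin s * yvar ^+ (1 + des s).

Definition NM (tau : seq nat) : nat -> Qxy := egf (NM_poly tau).

Definition catalan (n : nat) : rat := 'C(2 * n, n)%:R / n.+1%:R.

Definition Mmx (k : nat) : 'M[rat]_k :=
  \matrix_(i < k, j < k)
    if (i <= j)%N then catalan (3 * (j - i) + 2)
    else if i == j.+1 :> nat then -1 else 0.

(* The last column has no entry below the diagonal, hence no -1 or 0. *)
Definition Pmx (k : nat) : 'M[rat]_k :=
  \matrix_(i < k, j < k)
    if j.+1 == k :> nat then catalan (3 * (j - i) + 1) else Mmx k i j.

(* The conditions [6 k + 8 <= n] and [6 k + 6 <= n] are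
   [k <= floor((n - 8) / 6)] and [k <= floor((n - 6) / 6)]; in the summands
   they select no subtraction of naturals is truncated. *)
Definition U_rec (U : nat -> {poly rat}) (n : nat) : {poly rat} :=
  (1 - 'X) * U (n - 1)%N
  + \sum_(k < n | (6 * k + 8 <= n)%N)
      (\det (Mmx k.+1))%:P * 'X^(3 * k + 3) * U (n - (6 * k + 7))%N
  - \sum_(k < n | (6 * k + 6 <= n)%N)
      (\det (Pmx k.+1))%:P * 'X^(3 * k + 2)
        * (U (n - (6 * k + 4))%N + 'X * U (n - (6 * k + 5))%N).

Definition U_spec (U : nat -> {poly rat}) : Prop :=
  [/\ U 0%N = 1,
      U 1%N = - 'X
    & forall n : nat, (2 <= n)%N -> U n = U_rec U n].

Lemma U_spec_exists : exists U, U_spec U.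
Proof.
have rec_eq U V n : (0 < n)%N -> (forall m, (m < n)%N -> U m = V m) ->
    U_rec U n = U_rec V n.
  move=> n0 UV; have UVs d : (0 < d)%N -> U (n - d)%N = V (n - d)%N.
    by move=> d0; apply: UV; rewrite ltn_subrL d0.
  rewrite /U_rec UVs //; congr (_ + _ - _); apply: eq_bigr => k _;
    by rewrite !UVs // addnS.
pose next U : nat -> {poly rat} := fun n =>
  if n is n'.+1 then (if n' is 0 then - 'X else U_rec U n) else 1.
pose V N := iter N next (fun=> 0).
have VS N n : V N.+1 n.+2 = U_rec (V N) n.+2 by [].
have stab N n : (n < N)%N -> V N n = V n.+1 n.
  elim/ltn_ind: n N => -[|[|n]] IH [|N] // ltnN.
  rewrite !VS; apply: rec_eq => // m ltm.
  by rewrite IH ?(leq_trans ltm) // [RHS]IH.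
exists (fun n => V n.+1 n); split=> // -[|[|n]] // _.
by rewrite VS; apply: rec_eq => // m ltm; rewrite stab.
Qed.

(* Main.v *)
Require Import Defs.
From mathcomp Require Import all_boot all_order all_algebra all_fingroup.
From mathcomp Require Import ring zify.
From Stdlib Require Import FunctionalExtensionality.
Import GRing.Theory.
Local Open Scope ring_scope.

Set Implicit Arguments.
Unset Strict Implicit.
Unset Printing Implicit Defensive.

(** Write tau = 142536, F for the series NM(t,x,y) and F_1 for its value at
    x = 1.

    Only relative order matters for the weights involved, so a sum over S_n
    can be taken over the arrangements of any n letters, and cutting words in
    two turns into a product of exponential generating functions
    ([permsum_split]).

    The exponent x.  tau starts with its least letter, so an occurrence of
    tau in a word u m v with least letter m lies inside u or inside m v.  The
    left-to-right minima of u m v are those of u together with m.  Hence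
    F' = x F G, where G does not depend on x ([permsum_lrmin_wt]), and F is
    the x-th power of F_1.  It remains to prove U F_1 = 1.

    Clusters.  In F_1 a word carries y per descent and 1 per ascent.  Write
    the 1 of an ascent as y + (1-y), read the y of an adjacent pair outside
    all marked occurrences as a separator, and expand each factor
    1 - [occurrence here] by marking occurrences.  Words become sequences of
    pieces glued by y, whence F_1 = 1 / (1 - y K) with K the signed series of
    single pieces, called clusters: in a cluster each adjacent pair either is
    covered by a marked occurrence or is an ascent of weight 1 - y
    ([avoid_wt_cluster], [permsum_avoid_wt]).  So U_n = - y K_n for n > 0.

    Shape of the clusters.  tau overlaps itself in 1, 2 or 4 letters, and it
    starts with its minimum and ends with its maximum.  A cluster starts with
    its least letter; between the places where all letters so far are below
    all later ones, it consists of single letters and of blocks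
    e_1 o_2 e_2 o_3 ... e_p o_(p+1).  Two marks at distance 4 leave undecided
    whether there is an occurrence between them; if there is none, the word
    is cut at that place.  Summing over the marks thus makes the blocks
    independent, each with all its occurrences present, and the marks inside
    a block of length 2p only contribute a sign [block_sign p] of period 3 in
    p ([cluster_blocks]).  Blocks of length 2p are counted by Dyck paths
    without an intermediate return: there are C_(p-1) of them
    ([permsum_linked]).  With J_n the sum over the continuations after a
    lower letter, which may begin with a block, this gives
    ([cluster_sum_rec], [below_sum_rec])

      K_(n+1) = J_n - y K_n,
      J_n = K_n + sum over p of block_sign(p) C_(p-1) y^p J_(n-2p).

    Determinants.  Let Z = y^3 z^6 and W = y^2 z^4, z marking the length.
    The signs 1, 0, -1 turn the second line into
    (1 - Z sum C_(3k+2) Z^k) J + W (sum C_(3k+1) Z^k) J = K.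
    Expanding the Hessenberg determinants along the first column shows that
    the series of det M_k is the inverse of 1 - Z sum C_(3k+2) Z^k, and that
    this factor times the series of det P_(k+1) is sum C_(3k+1) Z^k.
    Multiplying by the series of det M_k gives
    J + W (sum det P_(k+1) Z^k) J = (sum det M_k Z^k) K,
    and the first line then yields the recurrence of U
    ([cluster_sum_detE]). *)

(** * Sums over the permutations of a list *)

Section PermSum.
Variable R : comNzRingType.
Implicit Types (f g : seq nat -> R) (s w : seq nat).

(** Relabelling the letters monotonically is what reduction to a permutation
    does, so these are the functions of [red w]; this form needs no reduction. *)
Definition order_invariant (T : Type) (f : seq nat -> T) :=
  forall w (h : nat -> nat), uniq w -> {in w &, {mono h : a b / (a < b)%N}} ->
    f (map h w) = f w.

Definition permsum f n := \sum_(w <- permutations (iota 0 n)) f w.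

Lemma mono_ltn_inj s (h : nat -> nat) :
  {in s &, {mono h : a b / (a < b)%N}} -> {in s &, injective h}.
Proof.
move=> hm a b sa sb hab; have := hm a b sa sb; have := hm b a sb sa.
by rewrite hab ltnn; case: ltngtP.
Qed.

Lemma perm_permutations_map s (h : nat -> nat) : uniq s -> {in s &, injective h} ->
  perm_eq (permutations (map h s)) (map (map h) (permutations s)).
Proof.
move=> us hi; apply: uniq_perm; first exact: permutations_uniq.
  rewrite map_inj_in_uniq ?permutations_uniq // => u v.
  rewrite !mem_permutations => su sv; apply: (inj_in_map hi).
    by apply/allP => x; rewrite (perm_mem su).
  by apply/allP => x; rewrite (perm_mem sv).
move=> t; rewrite mem_permutations; apply/idP/mapP => [st|[u]].
  have uh : uniq (map h s) by rewrite map_inj_in_uniq.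
  pose k x := nth 0%N s (index x (map h s)).
  have hk x : x \in map h s -> h (k x) = x.
    move=> sx; rewrite /k -(nth_map _ 0%N) ?nth_index //.
    by rewrite -(size_map h) index_mem.
  exists (map k t); last first.
    rewrite -map_comp -[LHS]map_id; apply/eq_in_map => x.
    by rewrite (perm_mem st) => /hk.
  rewrite mem_permutations (perm_trans (perm_map k st)) //.
  rewrite -map_comp (_ : map _ _ = s) //.
  rewrite -[RHS]map_id; apply/eq_in_map => x sx /=.
  by rewrite /k nth_index_map.
by rewrite mem_permutations => su ->; apply: perm_map.
Qed.

(** The increasing bijection from [0, size s) onto the letters of s carries
    one list of permutations to the other. *)
Lemma permsum_seq f s : order_invariant f -> uniq s ->
  \sum_(w <- permutations s) f w = permsum f (size s).
Proof.
move=> finv us; set t := sort leq s.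
have st : perm_eq t s by rewrite /t perm_sort.
have szt : size t = size s by rewrite /t size_sort.
have lt_t : sorted ltn t.
  by rewrite ltn_sorted_uniq_leq (perm_uniq st) us sort_sorted //; apply: leq_total.
have ht a b : (b < size s)%N -> (a < b)%N -> (nth 0%N t a < nth 0%N t b)%N.
  move=> hb hab; apply: (sorted_ltn_nth ltn_trans) => //; rewrite inE szt //.
  exact: ltn_trans hb.
have mt : {in iota 0 (size s) &, {mono nth 0%N t : a b / (a < b)%N}}.
  move=> a b; rewrite !mem_iota /= => ha hb; case: (ltngtP a b) => [hab|hba|->].
  - exact: ht.
  - by apply/negbTE; rewrite -leqNgt ltnW // ht.
  - by rewrite ltnn.
have map_t : map (nth 0%N t) (iota 0 (size s)) = t.
  by rewrite -szt -/(mkseq _ _) mkseq_nth.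
rewrite (perm_big _ (perm_permutations (_ : perm_eq s t))) /=; last by rewrite perm_sym.
rewrite -{1}map_t (perm_big _ (perm_permutations_map (iota_uniq _ _) (mono_ltn_inj mt))).
rewrite big_map /permsum !big_seq; apply: eq_bigr => w.
rewrite mem_permutations => sw; apply: finv; first by rewrite (perm_uniq sw) iota_uniq.
by move=> a b ha hb; apply: mt; rewrite -(perm_mem sw).
Qed.

Lemma perm_permutations_cat s1 s2 : uniq (s1 ++ s2) ->
  perm_eq [seq w <- permutations (s1 ++ s2) | perm_eq (take (size s1) w) s1]
          [seq u ++ v | u <- permutations s1, v <- permutations s2].
Proof.
move=> us; apply: uniq_perm.
- by rewrite filter_uniq ?permutations_uniq.
- apply: allpairs_uniq; try exact: permutations_uniq.
  move=> [u v] [u' v'] /allpairsP[[a b] /= [ha hb [-> ->]]].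
  move=> /allpairsP[[c d] /= [hc hd [-> ->]]] /eqP.
  move: ha hc; rewrite !mem_permutations => /perm_size ha /perm_size hc.
  by rewrite eqseq_cat ?ha ?hc // => /andP[/eqP-> /eqP->].
move=> w; rewrite mem_filter mem_permutations; apply/andP/allpairsP.
  case=> h1 h2; exists (take (size s1) w, drop (size s1) w).
  rewrite !mem_permutations h1 /= cat_take_drop; split=> //.
  rewrite -(perm_cat2l s1); apply: perm_trans h2.
  by rewrite -{2}(cat_take_drop (size s1) w) perm_cat2r perm_sym.
case=> -[u v] /=; rewrite !mem_permutations => -[hu hv ->].
rewrite -(perm_size hu) take_size_cat //; split=> //.
by apply: (perm_trans (y := u ++ s2)); rewrite ?perm_cat2l ?perm_cat2r.
Qed.

Lemma permsum_cat f g s1 s2 : order_invariant f -> order_invariant g ->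
  uniq (s1 ++ s2) ->
  \sum_(w <- permutations (s1 ++ s2) | perm_eq (take (size s1) w) s1)
     f (take (size s1) w) * g (drop (size s1) w)
  = permsum f (size s1) * permsum g (size s2).
Proof.
move=> finv ginv us; rewrite -big_filter (perm_big _ (perm_permutations_cat us)).
have /andP[us1 us2] : uniq s1 && uniq s2 by move: us; rewrite cat_uniq => /and3P[-> _ ->].
rewrite big_allpairs_dep -(permsum_seq finv us1) -(permsum_seq ginv us2).
rewrite mulr_suml big_seq [RHS]big_seq; apply: eq_bigr => u.
rewrite mem_permutations => hu; rewrite big_distrr; apply: eq_bigr => v _.
by rewrite -(perm_size hu) take_size_cat ?drop_size_cat.
Qed.

Definition cut k w := all (fun a => all (ltn a) (drop k w)) (take k w).

Lemma cut_perm_iota n k w : (k <= n)%N -> perm_eq w (iota 0 n) ->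
  cut k w = perm_eq (take k w) (iota 0 k).
Proof.
move=> le_kn hw; have szw : size w = n by rewrite (perm_size hw) size_iota.
have iotaE : iota 0 n = iota 0 k ++ iota k (n - k) by rewrite -{1}(subnKC le_kn) iotaD.
apply/idP/idP => [hc|hk].
  have hs : sort leq (take k w) ++ sort leq (drop k w) = iota 0 n.
    apply: (sorted_eq leq_trans anti_leq); last first.
    - apply: perm_trans hw; rewrite -{3}(cat_take_drop k w).
      by apply: perm_cat; rewrite perm_sort.
    - exact: iota_sorted.
    rewrite (sorted_pairwise leq_trans) pairwise_cat -!(sorted_pairwise leq_trans).
    rewrite !sort_sorted ?andbT; try exact: leq_total.
    apply/allrelP => a b; rewrite !mem_sort => ha hb.
    by apply: ltnW; move/allP: hc => /(_ _ ha)/allP/(_ _ hb).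
  have := congr1 (take k) hs; rewrite take_size_cat; last first.
    by rewrite size_sort size_take szw; case: ltngtP le_kn.
  rewrite iotaE take_size_cat ?size_iota // => <-.
  by rewrite perm_sym perm_sort.
have hd : perm_eq (drop k w) (iota k (n - k)).
  rewrite -(perm_cat2l (take k w)) cat_take_drop (perm_trans hw) // iotaE.
  by rewrite perm_cat2r perm_sym.
apply/allP => a; rewrite (perm_mem hk) mem_iota /= => ha.
by apply/allP => b; rewrite (perm_mem hd) mem_iota /= => /andP[hb _]; lia.
Qed.

(** Over a cut the prefix can only use the k least letters, so there is a
    single choice of its letter set: ordinary rather than exponential
    generating functions multiply. *)
Lemma permsum_cut f g n k : order_invariant f -> order_invariant g -> (k <= n)%N ->
  permsum (fun w => (cut k w)%:R * (f (take k w) * g (drop k w))) n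
  = permsum f k * permsum g (n - k).
Proof.
move=> finv ginv le_kn.
have iotaE : iota 0 n = iota 0 k ++ iota k (n - k) by rewrite -{1}(subnKC le_kn) iotaD.
have us : uniq (iota 0 k ++ iota k (n - k)) by rewrite -iotaE iota_uniq.
have := permsum_cat finv ginv us; rewrite -iotaE !size_iota => <-.
rewrite /permsum big_seq [RHS]big_seq_cond [RHS]big_mkcondr; apply: eq_bigr => w.
rewrite mem_permutations => hw; rewrite (cut_perm_iota le_kn hw).
by case: ifP => _; rewrite ?mul1r ?mul0r.
Qed.

(** Classify the words by the set A of letters of their prefix: each of the
    binomially many A contributes the same product. *)
Lemma permsum_split f g n k : order_invariant f -> order_invariant g -> (k <= n)%N ->
  permsum (fun w => f (take k w) * g (drop k w)) n
  = 'C(n, k)%:R * (permsum f k * permsum g (n - k)).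
Proof.
move=> finv ginv le_kn; pose letters (A : {set 'I_n}) := [seq val i | i <- enum A].
pose prefix w := [set i : 'I_n | val i \in take k w].
have us A : uniq (letters A ++ letters (~: A)).
  rewrite -map_cat map_inj_uniq; last exact: val_inj.
  rewrite cat_uniq !enum_uniq andbT /=; apply/hasPn => i.
  by rewrite !mem_enum inE.
have lettersE A : perm_eq (letters A ++ letters (~: A)) (iota 0 n).
  apply: uniq_perm => [||i]; rewrite ?iota_uniq // -map_cat mem_iota /= add0n.
  apply/mapP/idP => [[j _ ->] //|lt_in]; exists (Ordinal lt_in) => //.
  by rewrite mem_cat !mem_enum inE orbN.
have mem_letters A (i : 'I_n) : (val i \in letters A) = (i \in A).
  by rewrite mem_map ?mem_enum //; apply: val_inj.
have prefixP w : perm_eq w (iota 0 n) -> perm_eq (letters (prefix w)) (take k w).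
  move=> hw; apply: uniq_perm => [||a].
  - by rewrite map_inj_uniq ?enum_uniq //; apply: val_inj.
  - by rewrite take_uniq // (perm_uniq hw) iota_uniq.
  apply/mapP/idP => [[i]|ha]; first by rewrite mem_enum inE => hi ->.
  have := mem_take ha; rewrite (perm_mem hw) mem_iota /= add0n => lt_an.
  by exists (Ordinal lt_an); rewrite ?mem_enum ?inE.
have size_letters A : size (letters A) = #|A| by rewrite size_map -cardE.
rewrite /permsum big_seq (partition_big prefix (fun A => #|A| == k)) /=; last first.
  move=> w; rewrite mem_permutations => hw.
  rewrite -size_letters (perm_size (prefixP w hw)) size_takel //.
  by rewrite (perm_size hw) size_iota.
rewrite (eq_bigr (fun=> permsum f k * permsum g (n - k))) => [|A /eqP cardA].
  rewrite sumr_const mulr_natl -[in 'C(n, k)](card_ord n) -card_draws.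
  by rewrite cardsE.
have szA : size (letters A) = k by rewrite size_letters.
have szC : size (letters (~: A)) = (n - k)%N.
  by rewrite size_letters cardsCs setCK cardA card_ord.
have := permsum_cat finv ginv (us A); rewrite szA szC => <-.
rewrite (perm_big _ (perm_permutations (lettersE A))) /= [RHS]big_seq_cond.
apply: eq_bigl => w; rewrite mem_permutations; apply: andb_id2l => hw.
apply/eqP/idP => [<-|hA]; first by rewrite perm_sym prefixP.
apply/setP => i; rewrite -!mem_letters.
by rewrite (perm_mem (prefixP w hw)) (perm_mem hA).
Qed.

Lemma perm_permutations_insert (x : nat) s : uniq (x :: s) ->
  perm_eq (permutations (x :: s))
          [seq take k w ++ x :: drop k w | k <- iota 0 (size s).+1, w <- permutations s].
Proof.
move=> us; have /andP[xs us'] := us; apply: uniq_perm.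
- exact: permutations_uniq.
- apply: allpairs_uniq; rewrite ?permutations_uniq ?iota_uniq //.
  move=> [k u] [l v] /allpairsP[[a b] [ha hb [-> ->]]] /allpairsP[[c d] [hc hd [-> ->]]].
  move: ha hb hc hd; rewrite !mem_iota !mem_permutations /= => ha hb hc hd /eqP.
  have xb i : x \notin take i b by apply: contra xs => /mem_take; rewrite (perm_mem hb).
  have xd i : x \notin take i d by apply: contra xs => /mem_take; rewrite (perm_mem hd).
  have sb : size (take a b) = a by rewrite size_takel ?(perm_size hb).
  have sd : size (take c d) = c by rewrite size_takel ?(perm_size hd).
  move=> /eqP e; have := congr1 (index x) e.
  rewrite !index_cat (negbTE (xb _)) (negbTE (xd _)) /= eqxx !addn0 sb sd => eac.
  rewrite -eac in e sd *; congr (_, _); move/eqP: e; rewrite eqseq_cat ?sb //.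
  rewrite eqseq_cons eqxx /= => /andP[/eqP e1 /eqP e2].
  by rewrite -(cat_take_drop a b) e1 e2 cat_take_drop.
move=> w; rewrite mem_permutations; apply/idP/allpairsP => [hw|].
  have xw : x \in w by rewrite (perm_mem hw) inE eqxx.
  exists (index x w, take (index x w) w ++ drop (index x w).+1 w).
  have sz : size (take (index x w) w) = index x w by rewrite size_takel // index_size.
  have dE : drop (index x w) w = x :: drop (index x w).+1 w.
    by rewrite (drop_nth 0%N) ?index_mem // nth_index.
  have wE : w = take (index x w) w ++ x :: drop (index x w).+1 w.
    by rewrite -dE cat_take_drop.
  split.
  - rewrite mem_iota add0n /= -(perm_size hw : size w = (size s).+1).
    by rewrite index_mem.
  - rewrite mem_permutations -(perm_cons x); apply: perm_trans hw => /=.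
    rewrite [X in perm_eq _ X]wE.
    by rewrite perm_sym -[x :: drop _ _]cat1s perm_catCA.
  by rewrite /= take_size_cat // drop_size_cat // -wE.
case=> -[k u] [_]; rewrite mem_permutations /= => hu ->.
rewrite -[x :: drop _ _]cat1s perm_catCA /= perm_cons; apply: perm_trans hu.
by rewrite cat_take_drop.
Qed.

Lemma permsum_insert (F : seq nat -> R) (x : nat) s : uniq (x :: s) ->
  \sum_(w <- permutations (x :: s)) F w
  = \sum_(k < (size s).+1) \sum_(w <- permutations s) F (take k w ++ x :: drop k w).
Proof.
move=> us; rewrite (perm_big _ (perm_permutations_insert us)) big_allpairs_dep.
rewrite -(big_mkord xpredT (fun k => \sum_(w <- permutations s) F (take k w ++ x :: drop k w))).
by rewrite /index_iota subn0.
Qed.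

End PermSum.

(** * Marked matches *)

(** a b c d e f is order isomorphic to 142536 exactly when
    a < c < e < b < d < f. *)
Definition match_head w := if w is [:: a, b, c, d, e, f & _]
  then [&& a < c, c < e, e < b, b < d & d < f]%N else false.

(** What remains of [match_head] when the first letter is known to be below
    all others. *)
Definition match_tail w := if w is [:: b, c, d, e, f & _]
  then [&& c < e, e < b, b < d & d < f]%N else false.

Lemma match_head_cons a b c w : match_head [:: a, b, c & w] = (a < c)%N && match_tail [:: b, c & w].
Proof. by case: w => [|? [|? []]]; rewrite //= ?andbF. Qed.

Lemma match_head_size w : match_head w -> (5 < size w)%N.
Proof. by case: w => [|? [|? [|? [|? [|? []]]]]]. Qed.

Lemma match_head_take k w : match_head (take k w) = match_head w && (5 < k)%N.
Proof.
case: w => [|? [|? [|? [|? [|? [|? ?]]]]]];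
  by case: k => [|[|[|[|[|[|k]]]]]] //=; rewrite ?andbF ?andbT.
Qed.

Lemma match_head_asc a b w : match_head [:: a, b & w] -> (a < b)%N.
Proof. by case: w => [|? [|? [|? [|? ?]]]] //= /and5P[h1 h2 h3 _ _]; lia. Qed.

Section Words.
Variables (R : comNzRingType) (y : R).
Implicit Types (w : seq nat).

(** The empty word is given weight 0: it is not a piece of a factorisation. *)
Fixpoint avoid_wt w : R :=
  if w is a :: w' then
    if w' is b :: _ then y ^+ (b < a)%N * (~~ match_head w)%:R * avoid_wt w' else 1
  else 0.

(** Signed sum over the sets of marked occurrences, read from left to right.
    The counter c is the number of coming adjacent pairs that are already
    covered by a mark.  An uncovered pair keeps y^(descent) - y, which is 1 - y
    for an ascent and 0 for a descent; a new mark covers five pairs, its own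
    first one and four more, and its first pair is an ascent. *)
Fixpoint cluster w c : R :=
  if w is a :: w' then
    if w' is b :: _ then
      (if c is c'.+1 then y ^+ (b < a)%N * cluster w' c'
       else (y ^+ (b < a)%N - y) * cluster w' 0) - (match_head w)%:R * cluster w' 4
    else 1
  else 0.

Lemma avoid_wt_cons a b w :
  avoid_wt [:: a, b & w] = y ^+ (b < a)%N * (~~ match_head [:: a, b & w])%:R * avoid_wt (b :: w).
Proof. by []. Qed.

Lemma cluster_cons0 a b w :
  cluster [:: a, b & w] 0 = (y ^+ (b < a)%N - y) * cluster (b :: w) 0
                        - (match_head [:: a, b & w])%:R * cluster (b :: w) 4.
Proof. by []. Qed.

Lemma cluster_consS a b w c :
  cluster [:: a, b & w] c.+1 = y ^+ (b < a)%N * cluster (b :: w) c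
                        - (match_head [:: a, b & w])%:R * cluster (b :: w) 4.
Proof. by []. Qed.

Lemma sum_nat_from (F : nat -> R) l m n : (m <= l)%N ->
  \sum_(m <= k < n) (l <= k)%N%:R * F k = \sum_(l <= k < n) F k.
Proof.
move=> le_ml; case: (leqP l n) => [le_ln|lt_nl]; last first.
  rewrite [RHS]big_geq ?(ltnW lt_nl) // big_nat big1 // => k /andP[_ lt_kn].
  by rewrite leqNgt (ltn_trans lt_kn) // mul0r.
rewrite (big_cat_nat le_ml le_ln) /= big_nat big1 ?add0r => [|k /andP[_ lt_kl]].
  by rewrite !big_nat; apply: eq_bigr => k /andP[-> _]; rewrite mul1r.
by rewrite leqNgt lt_kl mul0r.
Qed.

(** F_1 = 1 / (1 - y K) at the level of words: the first factor of a word is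
    the cluster that ends at the first separator.  The separator cannot fall
    among the c covered pairs. *)
Lemma avoid_wt_cluster w c : (c < size w)%N -> (c <= 4)%N ->
  avoid_wt w = cluster w c
    + y * \sum_(c.+1 <= k < size w) cluster (take k w) c * avoid_wt (drop k w).
Proof.
elim: w c => [|a [|b w] IH] c //.
  by rewrite ltnS leqn0 => /eqP-> _; rewrite big_geq ?mulr0 ?addr0.
set v := b :: w in IH *; rewrite [size (a :: v)]/= ltnS => lt_c le_c.
rewrite big_add1 [_.+1.-1]/=.
have tail4 m : (m <= 5)%N ->
    (match_head (a :: v))%:R * avoid_wt v = (match_head (a :: v))%:R * (cluster v 4
      + y * \sum_(m <= k < size v) (5 <= k)%N%:R * (cluster (take k v) 4 * avoid_wt (drop k v))).
  move=> le_m5; case: (boolP (match_head _)) => [/match_head_size lt5|]; last by rewrite !mul0r.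
  by rewrite (sum_nat_from _ _ le_m5) (IH 4).
have take_v k : (0 < k)%N -> exists t, take k v = b :: t by case: k => // k _; exists (take k w).
have mhv k : (match_head (a :: take k v))%:R = (match_head (a :: v))%:R * (5 <= k)%N%:R :> R.
  by rewrite -[a :: take k v]/(take k.+1 (a :: v)) match_head_take -natrM mulnb.
have Ba : avoid_wt (a :: v) = y ^+ (b < a)%N * avoid_wt v - (match_head (a :: v))%:R * avoid_wt v.
  rewrite avoid_wt_cons -/v; case: (boolP (match_head _)) => [/match_head_asc lt_ab|_].
    by rewrite ltnNge (ltnW lt_ab) !mulr0n !mulr1n !(mulr0, mul0r, mul1r) subrr.
  by rewrite mulr1 mul0r subr0.
case: c lt_c le_c => [|c] lt_c le_c.
  rewrite big_ltn // -[take 1 _]/[:: a] -[drop 1 _]/v -[cluster [:: a] 0]/1 mul1r cluster_cons0 -/v.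
  rewrite Ba (tail4 1%N) // {1}(_ : y ^+ _ = (y ^+ (b < a)%N - y) + y); last by ring.
  rewrite mulrDl {1}(IH 0%N) //.
  rewrite (_ : \sum_(1 <= k < size v)
      cluster (take k.+1 (a :: v)) 0 * avoid_wt (drop k.+1 (a :: v)) =
     (y ^+ (b < a)%N - y) * (\sum_(1 <= k < size v) cluster (take k v) 0 * avoid_wt (drop k v))
     - (match_head (a :: v))%:R *
       \sum_(1 <= k < size v) (5 <= k)%N%:R * (cluster (take k v) 4 * avoid_wt (drop k v))); last first.
    rewrite !mulr_sumr -sumrB !big_nat; apply: eq_bigr => k /andP[k0 _].
    have [t et] := take_v k k0; rewrite -[take k.+1 _]/(a :: take k v) -[drop k.+1 _]/(drop k v).
    rewrite et cluster_cons0 -et mhv; ring.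
  ring.
have le_c5 : (c.+1 <= 5)%N by rewrite ltnW.
rewrite cluster_consS -/v Ba (tail4 _ le_c5) {1}(IH c lt_c (ltnW le_c)).
  rewrite (_ : \sum_(c.+1 <= k < size v)
      cluster (take k.+1 (a :: v)) c.+1 * avoid_wt (drop k.+1 (a :: v)) =
     y ^+ (b < a)%N * (\sum_(c.+1 <= k < size v) cluster (take k v) c * avoid_wt (drop k v))
     - (match_head (a :: v))%:R *
       \sum_(c.+1 <= k < size v) (5 <= k)%N%:R * (cluster (take k v) 4 * avoid_wt (drop k v))); last first.
    rewrite !mulr_sumr -sumrB !big_nat; apply: eq_bigr => k /andP[k0 _].
    have [t et] := take_v k (leq_ltn_trans (leq0n _) k0).
    rewrite -[take k.+1 _]/(a :: take k v) -[drop k.+1 _]/(drop k v).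
    rewrite et cluster_consS -et mhv; ring.
ring.
Qed.

End Words.

Arguments cluster : simpl never.
Arguments avoid_wt : simpl never.

(** * Decomposition of clusters into blocks *)

(** Blocks e_1 b_1 e_2 b_2 ... e_p b_p: both subsequences increase and each
    e_i exceeds b_(i+1).  Preceded by a lower letter and followed by higher
    ones, such a word contains an occurrence of 142536 at every second place
    and is not cut anywhere inside. *)
Fixpoint linked (u : seq nat) : bool :=
  if u is e :: b :: u' then
    if u' is e' :: b' :: _ then [&& b < b', b' < e, e < e' & linked u']%N
    else nilp u' && (b < e)%N
  else false.

Section Chain.
Variables (R : comNzRingType) (y : R).
Implicit Types (w : seq nat).

(** The signed number of subsets S of {1, ..., p-1}, each element counting -1,
    that contain 1 and p-1 and never miss two consecutive numbers: these are
    the sets of marks in a block of p pairs.  Removing the last mark leaves a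
    set for p-1 or for p-2. *)
Fixpoint block_sign p : R :=
  if p is p1.+1 then if p1 is p2.+1 then - (block_sign p2 + block_sign p1) else 0 else 1.

Local Notation cluster := (cluster y).

(** The weight of continuing with w after a letter below all of w, when the
    pair between them counts 1 instead of 1 - y: either no mark starts at that
    letter, or one does. *)
Definition below_wt w := cluster w 0 - (match_tail w)%:R * cluster w 4.

(** w as a first block of p pairs, followed by a continuation all of whose
    letters are higher; the sign sequence f is a parameter because reading
    the word from left to right shifts it. *)
Definition block_sum (f : nat -> R) w := \sum_(1 <= p < (size w)./2.+1)
  f p * y ^+ p * (cut p.*2 w && linked (take p.*2 w))%:R * below_wt (drop p.*2 w).

Lemma match_head_tail a b c w : (a < c)%N -> match_head [:: a, b, c & w] = match_tail [:: b, c & w].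
Proof. by move=> h; rewrite match_head_cons h. Qed.

Lemma match_headW a w : match_head (a :: w) -> (a < nth 0 w 1)%N /\ match_tail w.
Proof. by case: w => [|b [|c w]] //; rewrite match_head_cons => /andP[]. Qed.

Lemma match_tailP b c d e f w :
  reflect [/\ c < e, e < b, b < d & d < f]%N (match_tail [:: b, c, d, e, f & w]).
Proof. exact: and4P. Qed.

(** State after a mark on the letter before b.  No occurrence starts at the
    descent b c, and one starts at c exactly if [match_tail w]. *)
Lemma cluster4E b c w : match_tail [:: b, c & w] ->
  cluster [:: b, c & w] 4 = y * (cluster w 2 - (match_tail w)%:R * cluster w 4).
Proof.
case: w => [|d [|e [|f w]]] // h; have /match_tailP[h1 h2 h3 h4] := h.
have lt_cb : (c < b)%N by apply: ltn_trans h2.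
have nm6 : match_head [:: b, c, d, e, f & w] = false by apply/negbTE/negP => /match_head_asc; lia.
rewrite cluster_consS nm6 mul0r subr0 lt_cb expr1.
rewrite cluster_consS match_head_tail // (_ : (d < c)%N = false) ?expr0 ?mul1r //; lia.
Qed.

Lemma cluster2E e o e' w : (o < e)%N -> (o < e')%N ->
  cluster [:: e, o, e' & w] 2 =
  y * (cluster (e' :: w) 0 - (match_head [:: o, e' & w])%:R * cluster (e' :: w) 4).
Proof.
move=> lt_oe lt_oe'; rewrite cluster_consS lt_oe expr1.
rewrite (_ : match_head _ = false) ?mul0r ?subr0; last first.
  by apply/negbTE/negP => /match_head_asc; lia.
by rewrite cluster_consS [(e' < o)%N]ltnNge (ltnW lt_oe') expr0 mul1r.
Qed.

(** Nonzero terms come from chains of overlapping occurrences, and each of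
    these starts with its least letter.  The three cases are those with no,
    four and two covered pairs to come; in the latter two the first letter is
    an e and the second one the lower o after it. *)
Lemma cluster_support n w : (size w <= n)%N ->
  [/\ cluster w 0 != 0 -> all (leq (head 0%N w)) w,
      match_tail w -> cluster w 4 != 0 -> all (leq (nth 0%N w 1)) w
    & if w is [:: e, o, e' & _] then
        (o < e)%N -> (o < e')%N -> cluster w 2 != 0 -> all (leq o) w else true].
Proof.
elim: n w => [|n IH] w; first by rewrite leqn0 size_eq0 => /eqP->; rewrite /= eqxx.
have diff (u v : R) : u - v != 0 -> (u != 0) || (v != 0).
  by case: (eqVneq u 0) => [->|//]; rewrite sub0r oppr_eq0.
have diffM (u v : R) : y * (u - v) != 0 -> (u != 0) || (v != 0).
  by move=> h; apply: diff; apply: contra h => /eqP->; rewrite mulr0.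
have match_lead a v : (size v <= n)%N ->
    (match_head (a :: v))%:R * cluster v 4 != 0 -> all (leq a) v.
  move=> /IH[_ hv _]; case h6: (match_head (a :: v)); last by rewrite mul0r eqxx.
  rewrite mul1r; have [lt_a m5v] := match_headW h6.
  by move=> /(hv m5v); apply: sub_all => x; apply: leq_trans (ltnW lt_a).
move=> szw; split.
- case: w szw => [|a [|b w]]; rewrite ?eqxx //=; first by rewrite leqnn.
  move=> szw; rewrite leqnn cluster_cons0; case/diff/orP => [|/(match_lead _ (b :: w) szw)//].
  case: ltnP => [_|le_ab]; first by rewrite expr1 subrr mul0r eqxx.
  case: (eqVneq (cluster (b :: w) 0) 0) => [->|nz _]; first by rewrite mulr0 eqxx.
  have [/(_ nz) /= /andP[_ hb] _ _] := IH (b :: w) szw.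
  by apply: sub_all hb => x; apply: leq_trans.
- case: w szw => [|b [|c w]] // szw h; rewrite cluster4E //.
  have [h1 h2] : (c < b)%N /\ if w is [:: d, e, f & _] then (c < e /\ e < d /\ e < f)%N else False.
    by case: w h {szw} => [|d [|e [|f w]]] //= /and4P[*]; lia.
  have szw' : (size w <= n)%N by move: szw => /=; lia.
  rewrite /= leqnn (ltnW h1) /= => /diffM/orP[nz|nz].
    have [_ _] := IH w szw'; case: w h2 nz {szw szw' h} => [|d [|e [|f w]]] // [ce [ed ef]] nz.
    move=> /(_ ed ef nz); apply: sub_all => x; apply: leq_trans; exact: ltnW.
  have [_ hw _] := IH w szw'; case: (boolP (match_tail w)) nz => [mt|_]; rewrite ?mul0r ?eqxx // mul1r.
  move=> /(hw mt); apply: sub_all => x; apply: leq_trans.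
  by case: w h2 {szw szw' h hw mt} => [|d [|e [|f w]]] //= [ce _]; apply: ltnW.
case: w szw => [|e [|o [|e' w]]] // szw lt_oe lt_oe'; rewrite cluster2E //.
have szw' : (size (e' :: w) <= n)%N by move: szw => /=; lia.
move=> /diffM/orP[nz|nz].
  have [/(_ nz) h _ _] := IH _ szw'; rewrite /= (ltnW lt_oe) leqnn /=.
  by apply: sub_all h => x; apply: leq_trans; apply: ltnW.
by have h := match_lead _ _ szw' nz; rewrite /= (ltnW lt_oe) leqnn.
Qed.

Lemma cluster0_head w : cluster w 0 != 0 -> all (leq (head 0%N w)) w.
Proof. by have [] := cluster_support (leqnn (size w)). Qed.

Lemma cluster4_second w : match_tail w -> cluster w 4 != 0 -> all (leq (nth 0%N w 1)) w.
Proof. by have [] := cluster_support (leqnn (size w)). Qed.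

Lemma below_wt_nil : below_wt [::] = 0.
Proof. by rewrite /below_wt /= mul0r subr0. Qed.

Lemma block_sum_ext (f g : nat -> R) w : (forall p, (0 < p)%N -> f p = g p) ->
  block_sum f w = block_sum g w.
Proof.
by move=> fg; rewrite /block_sum !big_nat; apply: eq_bigr => p /andP[/fg-> _].
Qed.

Lemma block_sum_oppD (f g : nat -> R) w :
  block_sum (fun p => - (f p + g p)) w = - (block_sum f w + block_sum g w).
Proof.
by rewrite /block_sum -big_split -sumrN; apply: eq_bigr => p _ /=; ring.
Qed.

(** A block of more than one pair starts with two pairs linked to each
    other; given that something higher follows, this is [match_tail]. *)
Lemma block_sum_cons2 (f : nat -> R) e o w :
  block_sum f [:: e, o & w] = f 1%N * y * (cut 2 [:: e, o & w] && (o < e)%N)%:R * below_wt w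
    + (match_tail [:: e, o & w])%:R * y * block_sum (fun p => f p.+1) w.
Proof.
rewrite /block_sum [size _]/= big_ltn // big_add1 [_.+1.-1]/= expr1 [1.*2]/=.
rewrite -[take 2 [:: e, o & w]]/[:: e, o & take 0 w] take0.
rewrite -[drop 2 [:: e, o & w]]/(drop 0 w) drop0.
congr (_ + _); rewrite mulr_sumr !big_nat; apply: eq_bigr => p /andP[p0 _].
rewrite exprS doubleS -[take _.+2 _]/[:: e, o & take p.*2 w].
rewrite -[drop _.+2 _]/(drop p.*2 w).
have [/eqP->|nz] := boolP (below_wt (drop p.*2 w) == 0); first by rewrite !mulr0.
have lt_pw : (p.*2 < size w)%N.
  by rewrite ltnNge; apply: contra nz => /drop_oversize->; rewrite below_wt_nil.
suff -> : cut p.*2.+2 [:: e, o & w] && linked [:: e, o & take p.*2 w]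
    = match_tail [:: e, o & w] && (cut p.*2 w && linked (take p.*2 w)).
  by rewrite -mulnb natrM; ring.
case: p p0 {nz} lt_pw => // p _; case: w => [|e' [|o' [|x w]]] //.
rewrite [_.*2]/= [take _ _]/= [match_tail _]/= => lt_pw.
rewrite [cut p.*2.+4 _]/cut [cut p.*2.+2 _]/cut.
set u := [:: e', o' & take p.*2 (x :: w)].
set v := drop p.*2 (x :: w).
rewrite -[take p.*2.+4 _]/[:: e, o & u] -[take p.*2.+2 _]/u.
rewrite -[drop p.*2.+4 _]/v -[drop p.*2.+2 _]/v.
have -> : linked [:: e, o & u] = [&& o < o', o' < e, e < e' & linked u]%N by [].
set F := fun a => all (ltn a) v.
have -> : all F [:: e, o & u] = [&& F e, F o & all F u] by [].
have lt_e'x : all F u -> linked u -> (e' < x)%N.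
  rewrite /F /u /v; case: (p) => [|q]; first by rewrite take0 drop0 /= => /andP[/andP[]].
  by rewrite doubleS => _ /=; case: (take _ w) => [|z t] // /and4P[].
apply/idP/idP => [/andP[/and3P[_ _ hc] /and4P[-> -> -> hl]]|/and3P[/and4P[h1 h2 h3 _] hc hl]].
  by rewrite hc hl (lt_e'x hc hl).
rewrite h1 h2 h3 hc hl !andbT.
have hv : all (ltn e') v by case/and3P: hc.
have h4 : (o < e')%N by apply: ltn_trans h1 (ltn_trans h2 h3).
by apply/andP; split; apply: sub_all hv => z hz; [apply: ltn_trans hz|apply: ltn_trans hz].
Qed.

Lemma block_sum_small (f : nat -> R) w : (size w < 2)%N -> block_sum f w = 0.
Proof. by case: w => [|? []] // _; rewrite /block_sum big_geq. Qed.

Lemma block_sum_sign w : block_sum block_sign w = (match_tail w)%:R * block_sum block_sign w.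
Proof.
case: w => [|e [|o w]]; try by rewrite block_sum_small ?mulr0.
by rewrite block_sum_cons2 [block_sign 1]/= !mul0r add0r !mulrA -natrM mulnb andbb.
Qed.

(** The summation over marks.  The first part is the state right after a
    mark, with four covered pairs to come; the second is the state two letters
    later if no mark was set in between, with two covered pairs to come.
    There, if the unmarked occurrence is present the next one must be marked,
    and if it is absent the word is cut.  The recursion between the two states
    is that of [block_sign]. *)
Lemma cluster_blocks n w : (size w <= n)%N -> uniq w ->
  (match_tail w -> - cluster w 4 = block_sum block_sign w) /\
  (if w is [:: e, o, e' & _] then [&& o < e, o < e' & e < e']%N ->
     cluster w 2 = block_sum (fun p => block_sign p.-1) w else True).
Proof.
elim: n w => [|n IH] w; first by case: w.
move=> szw uw; split.
  case: w szw uw => [|b [|c w]] // szw uw mt.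
  have [] := IH w; [by move: szw => /=; lia|by case/and3P: uw|] => hX hY.
  rewrite cluster4E // block_sum_cons2 [block_sign 1]/= !mul0r add0r mt mul1r.
  rewrite (block_sum_ext (g := fun p => - (block_sign p.-1 + block_sign p))) => [|[|p] //].
  rewrite block_sum_oppD mulrN; congr (- (y * _)); congr (_ + _).
    case: w mt hY {hX szw uw} => [|d [|e [|f w]]] // /and4P[h1 h2 h3 h4]; apply.
    by rewrite (ltn_trans h2) // (ltn_trans h2) ?(ltn_trans h3).
  by rewrite [RHS]block_sum_sign; case: (boolP (match_tail w)) hX => [mt' /(_ isT)<-|_ _];
    rewrite ?mul1r ?mul0r ?oppr0.
case: w szw uw => [|e [|o [|e' w]]] // szw uw /and3P[lt_oe lt_oe' lt_ee'].
rewrite cluster2E // block_sum_cons2 mul1r; set w' := e' :: w in szw uw *.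
have [] := IH w'; [by move: szw => /=; lia|by case/and3P: uw|] => hX _.
rewrite lt_oe andbT.
have cutE : cut 2 [:: e, o & w'] = all (ltn e) w'.
  have -> : cut 2 [:: e, o & w'] = [&& all (ltn e) w', all (ltn o) w' & true] by [].
  by rewrite andbT; apply: andb_idr => h; apply: sub_all h => z; apply: ltn_trans.
rewrite cutE (block_sum_ext (g := block_sign)) => [|[|p]] //.
case: (boolP (match_tail [:: e, o & w'])) => [mt|nmt].
  (* the unmarked occurrence is present: no cut, and the next one is marked *)
  have [o' [t [wE lt_oo' lt_o'e]]] : exists o' t, [/\ w = o' :: t, o < o' & o' < e]%N.
    move: mt; rewrite /w'; case: (w) => [|o' [|e'' t]] // /and4P[h1 h2 _ _].
    by exists o', (e'' :: t).
  have o'w' : o' \in w' by rewrite /w' wE !inE eqxx orbT.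
  have k0 : cluster w' 0 = 0.
    apply/eqP/negPn/negP => /cluster0_head/allP/(_ _ o'w') /=; lia.
  have -> : all (ltn e) w' = false.
    by apply/negbTE/negP => /allP/(_ _ o'w') /=; lia.
  have -> : match_head [:: o & w'] = match_tail w' by rewrite /w' wE match_head_tail.
  rewrite k0 mulr0 mul0r !add0r mul1r; congr (_ * _).
  rewrite block_sum_sign; case: (boolP (match_tail w')) hX => [_ /(_ isT)<-|_ _]; last by rewrite !mul0r oppr0.
  by rewrite !mul1r.
(* it is absent: every nonzero continuation is cut off from e and o *)
rewrite !mul0r addr0 -mulrA; congr (_ * _); rewrite /below_wt mulrBr; congr (_ - _).
  case: (eqVneq (cluster w' 0) 0) => [->|/cluster0_head]; first by rewrite mulr0.
  move=> h; rewrite (_ : all _ _) ?mul1r //.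
  by apply: sub_all h => z /=; apply: leq_trans.
rewrite mulrA -natrM mulnb; case: (boolP (match_tail w')) => [mt'|nmt']; last first.
  have -> : match_head (o :: w') = false by apply: contraNF nmt' => /match_headW[].
  by rewrite andbF.
case: (eqVneq (cluster w' 4) 0) => [->|nz]; first by rewrite !mulr0.
have hmin := cluster4_second mt' nz; rewrite andbT; congr (_%:R * _); congr nat_of_bool.
move: hmin mt' nmt uw; rewrite /w'; case: w {w' szw hX cutE nz} => [|o' [|e'' w]] //.
move=> hmin mt' nmt uw; rewrite match_head_cons mt' andbT.
have neq_eo' : e != o'.
  by move: uw; rewrite /= !inE !negb_or => /and4P[/and4P[_ _ -> _] _ _ _].
apply/idP/idP => [lt_oo'|/and3P[_ lt_eo' _]]; last by apply: ltn_trans lt_eo'.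
have lt_eo' : (e < o')%N.
  rewrite ltn_neqAle neq_eo' leqNgt; apply: contra nmt => lt_o'e.
  case: w mt' {hmin uw} => [|a [|c w]] // /and4P[k1 k2 k3 k4].
  by apply/and4P; split.
by apply: sub_all hmin => z /=; apply: leq_trans.
Qed.

Lemma cluster4_blocks w : uniq w -> (match_tail w)%:R * cluster w 4 = - block_sum block_sign w.
Proof.
move=> uw; have [h _] := cluster_blocks (leqnn (size w)) uw.
by rewrite block_sum_sign; case: (boolP (match_tail w)) h => [_ /(_ isT)<-|_ _];
  rewrite ?mul0r ?mul1r ?opprK ?oppr0.
Qed.

Lemma below_wtE w : uniq w -> below_wt w = cluster w 0 + block_sum block_sign w.
Proof. by move=> uw; rewrite /below_wt cluster4_blocks // opprK. Qed.

(** The first letter is the least one, and the pair that it starts is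
    uncovered (1 - y) or begins a mark. *)
Lemma cluster0_cons a w : uniq (a :: w) ->
  cluster (a :: w) 0 = (all (ltn a) w)%:R * (if nilp w then 1 else below_wt w - y * cluster w 0).
Proof.
case: w => [|b w] uw; first by rewrite mul1r.
rewrite [nilp _]/= cluster_cons0 /below_wt.
have -> : (y ^+ (b < a)%N - y) * cluster (b :: w) 0
    = (all (ltn a) (b :: w))%:R * ((1 - y) * cluster (b :: w) 0).
  case: (eqVneq (cluster (b :: w) 0) 0) => [->|/cluster0_head /= /andP[_ hb]]; first by rewrite !mulr0.
  case: (ltngtP b a) => [lt_ba|lt_ab|eq_ab].
  - by rewrite expr1 subrr !mul0r.
  - rewrite (_ : all _ _) ?expr0 ?mul1r //.
    by apply: sub_all hb => z /=; apply: leq_trans.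
  - by move: uw; rewrite eq_ab /= inE eqxx.
have -> : (match_head [:: a, b & w])%:R * cluster (b :: w) 4
    = (all (ltn a) (b :: w))%:R * ((match_tail (b :: w))%:R * cluster (b :: w) 4).
  case: w uw => [|c w] uw; first by rewrite !(mul0r, mulr0).
  rewrite match_head_cons -mulnb natrM -mulrA; case: (boolP (match_tail _)) => [mt|]; last by rewrite mul0r !mulr0.
  rewrite mul1r; case: (eqVneq (cluster [:: b, c & w] 4) 0) => [->|nz]; first by rewrite !mulr0.
  have hmin := cluster4_second mt nz; congr (_%:R * _); congr nat_of_bool.
  apply/idP/idP => [lt_ac|/and3P[_ ? _] //].
  by apply: sub_all hmin => z /=; apply: leq_trans.
by rewrite -mulrBr mulrBl mul1r addrAC.
Qed.

End Chain.

(** * Counting blocks by ballot numbers *)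

Fixpoint dominated (xs es : seq nat) : bool :=
  if xs is x :: xs' then if es is e :: es' then (x < e)%N && dominated xs' es' else true
  else true.

Lemma dominated_rconsl xs es m :
  dominated (rcons xs m) es
  = dominated xs es && ((size xs < size es) ==> (m < nth 0 es (size xs)))%N.
Proof.
elim: xs es => [|x xs IH] [|e es] //=; first by case: es; rewrite ?andbT.
by rewrite IH andbA ltnS.
Qed.

Lemma dominated_rconsr xs es m :
  dominated xs (rcons es m)
  = dominated xs es && ((size es < size xs) ==> (nth 0 xs (size es) < m))%N.
Proof.
elim: xs es => [|x xs IH] [|e es] //=; first by case: xs {IH} => [|? ?] /=; rewrite ?andbT.
by rewrite IH andbA ltnS.
Qed.

(** Inserting the letters in increasing order, this says that b_(i+1) comes
    before e_i; no condition is put on e_i when b_(i+1) does not exist, as for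
    the last e of a block. *)
Definition ballot bs es := [&& sorted ltn bs, sorted ltn es & dominated (behead bs) es].

Fixpoint odds (u : seq nat) := if u is e :: b :: u' then b :: odds u' else [::].
Fixpoint evens (u : seq nat) := if u is e :: b :: u' then e :: evens u' else [::].

Lemma size_odds u : size (odds u) = (size u)./2.
Proof.
have [n] := ubnP (size u); elim: n u => // n IH [|a [|b u]] //= hn.
by rewrite IH //; lia.
Qed.

(** The condition on the last letters makes the last e the largest letter of
    the block. *)
Lemma linked_ballot p u : size u = p.+1.*2 ->
  linked u = ballot (odds u) (evens u) && (last 0 (odds u) < last 0 (evens u))%N.
Proof.
elim: p u => [|p IH] [|e [|b u]] // [szu].
  by case: u szu.
case: u szu => [|e' [|b' t]] // szu.
have -> : linked [:: e, b, e', b' & t]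
    = [&& b < b', b' < e, e < e' & linked [:: e', b' & t]]%N by [].
rewrite IH // /ballot -[odds [:: e, b, e', b' & t]]/[:: b, b' & odds t].
rewrite -[odds [:: e', b' & t]]/(b' :: odds t) -[evens [:: e', b' & t]]/(e' :: evens t).
rewrite -[evens [:: e, b, e', b' & t]]/[:: e, e' & evens t].
set os := odds t; set es := evens t.
have sorted2 (x1 x2 : nat) xs : sorted ltn [:: x1, x2 & xs] = (x1 < x2)%N && sorted ltn (x2 :: xs) by [].
have lastE (x1 x2 : nat) xs : last 0%N [:: x1, x2 & xs] = last 0%N (x2 :: xs) by [].
rewrite !sorted2 !lastE -[dominated (behead [:: b, b' & os]) _]/((b' < e)%N && dominated os (e' :: es)).
rewrite -[behead (b' :: os)]/os.
by case: (_ < _)%N; case: (b' < e)%N; case: (e < e')%N; rewrite /= ?andbF.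
Qed.

Lemma perm_odds_evens p u : size u = p.*2 -> perm_eq (odds u ++ evens u) u.
Proof.
elim: p u => [|p IH] [|e [|b u]] // [szu].
apply/seq.permP => P; have /seq.permP/(_ P) := IH u szu.
by rewrite /= !count_cat /=; lia.
Qed.

Lemma odds_evens_inj p u v : size u = p.*2 -> size v = p.*2 ->
  odds u ++ evens u = odds v ++ evens v -> u = v.
Proof.
move=> su sv /eqP; rewrite eqseq_cat ?size_odds ?su ?sv // => /andP[/eqP h1 /eqP h2].
elim: p u v su sv h1 h2 => [|p IH] [|e [|b u]] [|e' [|b' v]] // [su] [sv] [-> h1] [-> h2].
by rewrite (IH u v).
Qed.

Lemma perm_map_odds_evens p :
  perm_eq [seq odds u ++ evens u | u <- permutations (iota 0 p.*2)]
          (permutations (iota 0 p.*2)).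
Proof.
have szP u : u \in permutations (iota 0 p.*2) -> size u = p.*2.
  by rewrite mem_permutations => /perm_size; rewrite size_iota.
have um : uniq [seq odds u ++ evens u | u <- permutations (iota 0 p.*2)].
  rewrite map_inj_in_uniq ?permutations_uniq // => u v /szP su /szP sv.
  exact: odds_evens_inj su sv.
apply: uniq_perm; rewrite ?permutations_uniq //.
suff sub : {subset [seq odds u ++ evens u | u <- permutations (iota 0 p.*2)]
                   <= permutations (iota 0 p.*2)}.
  by have [|] := uniq_min_size um sub; rewrite ?size_map.
move=> _ /mapP[u hu ->]; have su := szP u hu; move: hu; rewrite !mem_permutations.
exact: perm_trans (perm_odds_evens su).
Qed.

Lemma sorted_max_last m u v : all (gtn m) v -> sorted ltn (u ++ m :: v) -> v = [::].
Proof.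
case: v => // x v /= /andP[lt_xm _]; rewrite sorted_cat_cons /= => /and3P[_ h _].
by move: h; rewrite ltnNge ltnW.
Qed.

Lemma sorted_rcons_max m u : all (gtn m) u -> sorted ltn (rcons u m) = sorted ltn u.
Proof.
case: u => [|x u] // /allP h; rewrite /= rcons_path andb_idr // => _.
exact: h (mem_last _ _).
Qed.

Section Count.
Variable R : comNzRingType.

Lemma permsum_insert_max (F : seq nat -> R) n :
  permsum F n.+1 = \sum_(k < n.+1) permsum (fun w => F (take k w ++ n :: drop k w)) n.
Proof.
have un : uniq (n :: iota 0 n) by rewrite /= iota_uniq mem_iota /= add0n ltnn.
have := permsum_insert F un; rewrite size_iota /permsum => <-.
apply: perm_big; apply: perm_permutations; rewrite -addn1 iotaD.
by rewrite perm_sym -cat1s perm_catC.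
Qed.

Lemma eq_permsum (F G : seq nat -> R) n :
  (forall w, perm_eq w (iota 0 n) -> F w = G w) -> permsum F n = permsum G n.
Proof.
move=> FG; rewrite /permsum big_seq [RHS]big_seq; apply: eq_bigr => w.
by rewrite mem_permutations => /FG.
Qed.

Lemma permsum0 (F : seq nat -> R) n :
  (forall w, perm_eq w (iota 0 n) -> F w = 0) -> permsum F n = 0.
Proof.
move=> F0; rewrite /permsum big_seq big1 // => w.
by rewrite mem_permutations => /F0.
Qed.

Definition ballot_count i j : R :=
  permsum (fun w => (ballot (take i w) (drop i w))%:R) (i + j).

Lemma ballot_count0 i : ballot_count i 0 = 1.
Proof.
rewrite /ballot_count addn0 /permsum (bigD1_seq (iota 0 i)) ?permutations_uniq ?mem_permutations //=.
rewrite take_oversize ?drop_oversize ?size_iota // /ballot iota_ltn_sorted /=.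
have dom0 xs : dominated xs [::] by case: xs.
rewrite dom0 big_seq_cond big1 ?addr0 // => w; rewrite mem_permutations => /andP[hw].
have szw : size w = i by rewrite (perm_size hw) size_iota.
rewrite take_oversize ?drop_oversize ?szw // => neq; case: (boolP (sorted _ _)) => // sw.
case/eqP: neq; apply: (sorted_eq leq_trans anti_leq) hw; last exact: iota_sorted.
by move: sw; rewrite ltn_sorted_uniq_leq => /andP[].
Qed.

(** The largest letter ends one of the two increasing sequences.  It can end
    the first one only if no e is required to exceed it, that is, if j < i. *)
Lemma ballot_count_rec i j : (j <= i)%N ->
  ballot_count i.+2 j.+1 = ballot_count i.+2 j + (j < i)%N%:R * ballot_count i.+1 j.+1.
Proof.
move=> le_ji; rewrite /ballot_count addnS permsum_insert_max big_ord_recr /=.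
have lt_i : (i.+1 < i.+2 + j)%N by rewrite addSn ltnS leq_addr.
rewrite (bigD1 (Ordinal lt_i)) //= big1 ?addr0 => [|k neq_k]; last first.
  apply: permsum0 => w hw.
  have maxw t : {subset t <= w} -> all (gtn (i.+2 + j)) t.
    by move=> tw; apply/allP => x /tw; rewrite (perm_mem hw) mem_iota.
  have szw : size w = (i.+2 + j)%N by rewrite (perm_size hw) size_iota.
  have szt : size (take k w) = k by rewrite size_takel // szw ltnW.
  (* elsewhere the largest letter is followed by another one in its sequence *)
  rewrite /ballot; have [lt_ki|le_ik] := ltnP k i.+2.
    rewrite take_cat szt ltnNge (ltnW lt_ki) /= subSn // [take _.+1 _]/=.
    case: (boolP (sorted _ _)) => // /sorted_max_last h.
    have sub : {subset take (i.+1 - k) (drop k w) <= w} by move=> x /mem_take/mem_drop.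
    have := congr1 size (h (maxw _ sub)); rewrite size_takel ?size_drop ?szw; last by lia.
    have neq : k <> i.+1 :> nat by move=> e; case/eqP: neq_k; apply: val_inj.
    by move=> /=; lia.
  have -> : drop i.+2 (take k w ++ (i.+2 + j)%N :: drop k w)
      = drop i.+2 (take k w) ++ (i.+2 + j)%N :: drop k w.
    rewrite drop_cat szt; case: ltnP => // le_ki.
    have -> : k = i.+2 :> nat by apply/eqP; rewrite eqn_leq le_ki.
    by rewrite subnn drop0 [drop _ (take _ _)]drop_oversize ?size_take_min ?geq_minl.
  case: (boolP (sorted ltn (drop _ _ ++ _))) => [/sorted_max_last h|_]; last by rewrite andbF.
  have sub : {subset drop k w <= w} by move=> x /mem_drop.
  have := congr1 size (h (maxw _ sub)); rewrite size_drop szw.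
  by have := ltn_ord k; move=> /=; lia.
rewrite addrC; congr (_ + _).
  apply: eq_permsum => w hw.
  have szw : size w = (i.+2 + j)%N by rewrite (perm_size hw) size_iota.
  have lt_x x : x \in w -> (x < i.+2 + j)%N by rewrite (perm_mem hw) mem_iota.
  have -> : take (i.+2 + j) w = w by rewrite -szw take_size.
  have -> : drop (i.+2 + j) w = [::] by rewrite -szw drop_size.
  rewrite takel_cat ?szw ?leq_addr //.
  rewrite cats1 drop_rcons ?szw ?leq_addr // /ballot dominated_rconsr.
  rewrite sorted_rcons_max; last by apply/allP => x /mem_drop/lt_x.
  congr ((_ && (_ && _))%:R); rewrite andb_idr // => _; apply/implyP => hs.
  by apply/lt_x/(@mem_take i.+2)/mem_behead/mem_nth.
rewrite -addSnnS /permsum mulr_sumr; apply: eq_permsum => w hw.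
have szw : size w = (i.+2 + j)%N by rewrite (perm_size hw) size_iota.
have lt_x x : x \in w -> (x < i.+2 + j)%N by rewrite (perm_mem hw) mem_iota.
have szt : size (take i.+1 w) = i.+1 by rewrite size_takel // szw addSn ltnW // ltnS leq_addr.
rewrite -cat_rcons take_cat drop_cat size_rcons szt ltnn subnn take0 drop0 cats0.
rewrite /ballot sorted_rcons_max; last by apply/allP => x /mem_take/lt_x.
case: (take i.+1 w) szt => [|x t] // [szt]; rewrite [behead (rcons _ _)]/= dominated_rconsl szt.
rewrite size_drop szw (_ : (i.+2 + j - i.+1)%N = j.+1); last by lia.
rewrite [behead _]/= ltnS -natrM mulnb; congr (nat_of_bool _)%:R.
have -> : ((i <= j) ==> (i.+2 + j < nth 0 (drop i.+1 w) i))%N = (j < i)%N.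
  case: (leqP i j) => //= le_ij; apply/negbTE; rewrite -leqNgt ltnW //.
  by apply/lt_x/(@mem_drop i.+1)/mem_nth; rewrite size_drop szw; lia.
by case: (j < i)%N; rewrite ?andbT ?andbF.
Qed.

Lemma ballot_countE i j : (j <= i)%N ->
  ballot_count i.+1 j = 'C(i + j, j)%:R - (if j is j'.+1 then 'C(i + j, j') else 0)%:R.
Proof.
elim: i j => [|i IHi] j; first by rewrite leqn0 => /eqP->; rewrite ballot_count0 bin0 subr0.
elim: j => [|j IHj] le_ji; first by rewrite ballot_count0 bin0 subr0.
rewrite ballot_count_rec // IHj ?(ltnW le_ji) //.
have -> : (j < i)%N%:R * ballot_count i.+1 j.+1
    = 'C(i + j.+1, j.+1)%:R - 'C(i + j.+1, j)%:R.
  have := le_ji; rewrite ltnS leq_eqVlt => /predU1P[->|lt_ji].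
    rewrite ltnn mul0r -(bin_sub (n := i + i.+1) (m := i)) ?leq_addr //.
    by rewrite addKn subrr.
  by rewrite lt_ji mul1r IHi.
rewrite !addnS [(i.+1 + j)%N]addSn; set n := (i + j).+1.
have pascal : 'C(n.+1, j)%:R
    = 'C(n, j)%:R + (if j is j'.+1 then 'C(n, j') else 0)%:R :> R.
  by case: (j) => [|j']; rewrite ?bin0 ?addr0 // binS natrD.
by rewrite pascal binS natrD; ring.
Qed.

Lemma sorted_le_last x s : sorted ltn s -> x \in s -> (x <= last 0 s)%N.
Proof.
case: (lastP s) => // t z; rewrite (sorted_pairwise ltn_trans) pairwise_rcons last_rcons.
by case/andP => /allP h _; rewrite mem_rcons inE => /predU1P[->|/h/ltnW].
Qed.

(** The largest letter of a block is its last e; removing it leaves a ballot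
    pair of lengths p+1 and p.  The value is the Catalan number of index p. *)
Lemma permsum_linked p :
  permsum (fun u => (linked u)%:R) p.+1.*2 = 'C(p.*2, p)%:R - 'C(p.*2, p.+1)%:R :> R.
Proof.
pose F w : R := (ballot (take p.+1 w) (drop p.+1 w)
                 && (last 0 (take p.+1 w) < last 0 (drop p.+1 w)))%N%:R.
transitivity (permsum F p.+1.*2).
  symmetry; rewrite /permsum -(perm_big _ (perm_map_odds_evens p.+1)) big_map.
  apply: eq_permsum => u hu; have szu : size u = p.+1.*2 by rewrite (perm_size hu) size_iota.
  have szo : size (odds u) = p.+1 by rewrite size_odds szu doubleK.
  by rewrite (linked_ballot szu) /F take_size_cat // drop_size_cat.
rewrite doubleS permsum_insert_max big_ord_recr big1 /= ?add0r => [|k _]; last first.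
  apply: permsum0 => w hw; rewrite /F.
  have szw : size w = p.*2.+1 by rewrite (perm_size hw) size_iota.
  have szt : size (take k w) = k by rewrite size_takel // szw ltnW.
  set W := take k w ++ _; case: (boolP (ballot _ _ && _)) => // /andP[/and3P[sb se _] lt_last].
  have szW : size W = p.*2.+2 by rewrite size_cat /= size_drop szt szw; have := ltn_ord k; lia.
  have lastW : last 0%N W = last 0%N (drop p.+1 W).
    rewrite -{1}(cat_take_drop p.+1 W) last_cat.
    case e: (drop p.+1 W) => [|x t] //; have := congr1 size e.
    by rewrite size_drop szW /=; lia.
  have mW : p.*2.+1 \in W by rewrite mem_cat !inE eqxx orbT.
  have : (p.*2.+1 <= last 0 W)%N.
    move: mW; rewrite -{1}(cat_take_drop p.+1 W) mem_cat lastW => /orP[] h.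
      exact: leq_trans (sorted_le_last sb h) (ltnW lt_last).
    exact: sorted_le_last se h.
  rewrite /W last_cat /=; case e: (drop k w) => [|x t].
    by have := congr1 size e; rewrite size_drop szw /=; have := ltn_ord k; lia.
  have /(@mem_drop k) : last x t \in drop k w by rewrite e mem_last.
  by rewrite (perm_mem hw) mem_iota /=; lia.
have -> : permsum (fun w => F (take p.*2.+1 w ++ p.*2.+1 :: drop p.*2.+1 w)) p.*2.+1
    = ballot_count p.+1 p.
  rewrite /ballot_count addSn addnn; apply: eq_permsum => w hw; rewrite /F.
  have szw : size w = p.*2.+1 by rewrite (perm_size hw) size_iota.
  have lt_x x : x \in w -> (x < p.*2.+1)%N by rewrite (perm_mem hw) mem_iota.
  have -> : take p.*2.+1 w = w by rewrite -szw take_size.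
  have -> : drop p.*2.+1 w = [::] by rewrite -szw drop_size.
  have le_p : (p.+1 <= size w)%N by rewrite szw ltnS -addnn leq_addr.
  have szt := size_takel le_p.
  rewrite takel_cat // cats1 drop_rcons // last_rcons /ballot dominated_rconsr.
  rewrite sorted_rcons_max; last by apply/allP => x /mem_drop/lt_x.
  rewrite size_behead szt size_drop szw (_ : (p.*2.+1 - p.+1 < p)%N = false); last by lia.
  rewrite andbT andb_idr // => _; apply/lt_x/(@mem_take p.+1).
  by case: (take p.+1 w) szt => // x t _; apply: mem_last.
rewrite ballot_countE // addnn; congr (_ - _%:R).
case: (p) => [|q]; first by rewrite bin0n.
by rewrite -(@bin_sub q.+1.*2 q.+2); [congr 'C(_, _); lia | lia].
Qed.

End Count.

(** * The two recurrences for sums over permutations *)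

Lemma catalanE p : catalan p = 'C(p.*2, p)%:R - 'C(p.*2, p.+1)%:R.
Proof.
rewrite /catalan mul2n; apply: (canLR (mulfK _)); first by rewrite Num.Theory.pnatr_eq0.
have h : (p.+1 * 'C(p.*2, p.+1))%N = (p * 'C(p.*2, p))%N.
  by rewrite mul_bin_left -addnn addnK.
rewrite mulrBl -!natrM [('C(_, p.+1) * _)%N]mulnC h mulnS [(_ * p)%N]mulnC natrD; ring.
Qed.

Section Invariance.
Variables (R : comNzRingType) (y : R).

Lemma mono_behead (h : nat -> nat) a w :
  {in a :: w &, {mono h : a b / (a < b)%N}} -> {in w &, {mono h : a b / (a < b)%N}}.
Proof. by move=> hm b c hb hc; apply: hm; rewrite inE ?hb ?hc orbT. Qed.

Lemma match_head_map (h : nat -> nat) w :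
  {in w &, {mono h : a b / (a < b)%N}} -> match_head (map h w) = match_head w.
Proof.
case: w => [|? [|? [|? [|? [|? [|? w]]]]]] // hm.
by rewrite /match_head /= !hm // !inE eqxx ?orbT.
Qed.

Lemma match_tail_map (h : nat -> nat) w :
  {in w &, {mono h : a b / (a < b)%N}} -> match_tail (map h w) = match_tail w.
Proof.
case: w => [|? [|? [|? [|? [|? w]]]]] // hm.
by rewrite /match_tail /= !hm // !inE eqxx ?orbT.
Qed.

Lemma cluster_map (h : nat -> nat) w c :
  {in w &, {mono h : a b / (a < b)%N}} -> cluster y (map h w) c = cluster y w c.
Proof.
elim: w c => [|a w IH] c hm //; have hm' := mono_behead hm.
case: w IH hm hm' => [|b w] // IH hm hm'.
have hab : (h b < h a)%N = (b < a)%N by apply: hm; rewrite !inE eqxx ?orbT.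
have mhE : match_head [:: h a, h b & map h w] = match_head [:: a, b & w] by rewrite -(match_head_map hm).
have clE c' : cluster y (h b :: map h w) c' = cluster y (b :: w) c' := IH c' hm'.
by case: c => [|c]; rewrite [map h _]/= ?cluster_cons0 ?cluster_consS mhE !clE hab.
Qed.

Lemma avoid_wt_map (h : nat -> nat) w :
  {in w &, {mono h : a b / (a < b)%N}} -> avoid_wt y (map h w) = avoid_wt y w.
Proof.
elim: w => [|a w IH] hm //; have hm' := mono_behead hm.
case: w IH hm hm' => [|b w] // IH hm hm'.
have hab : (h b < h a)%N = (b < a)%N by apply: hm; rewrite !inE eqxx ?orbT.
have mhE : match_head [:: h a, h b & map h w] = match_head [:: a, b & w] by rewrite -(match_head_map hm).
have BE : avoid_wt y (h b :: map h w) = avoid_wt y (b :: w) := IH hm'.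
by rewrite [map h _]/= !avoid_wt_cons mhE BE hab.
Qed.

Lemma linked_map (h : nat -> nat) w :
  {in w &, {mono h : a b / (a < b)%N}} -> linked (map h w) = linked w.
Proof.
have [n] := ubnP (size w); elim: n w => // n IH [|a [|b w]] // sz hm.
have sz' : (size w < n)%N by move: sz => /=; lia.
have hm' := mono_behead (mono_behead hm).
case: w sz sz' hm hm' => [|a' [|b' w]] // sz sz' hm hm'; first by rewrite /= hm // !inE eqxx ?orbT.
rewrite -[linked (map _ _)]/[&& h b < h b', h b' < h a, h a < h a' & linked (map h [:: a', b' & w])]%N.
by rewrite IH // !hm // !inE eqxx ?orbT.
Qed.

Lemma cluster_invariant c : order_invariant (fun w => cluster y w c).
Proof. by move=> w h _; apply: cluster_map. Qed.

Lemma avoid_wt_invariant : order_invariant (avoid_wt y).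
Proof. by move=> w h _; apply: avoid_wt_map. Qed.

Lemma linked_invariant : order_invariant (fun w => (linked w)%:R : R).
Proof. by move=> w h _ hm; rewrite linked_map. Qed.

Lemma below_wt_invariant : order_invariant (below_wt y).
Proof. by move=> w h _ hm; rewrite /below_wt !cluster_map ?match_tail_map. Qed.

Definition cluster_sum n := permsum (fun w => cluster y w 0) n.
Definition below_sum n := permsum (below_wt y) n.

Lemma permsum_nil (F : seq nat -> R) : permsum F 0 = F [::].
Proof. by rewrite /permsum big_seq1. Qed.

Lemma permsum_single (F : seq nat -> R) : permsum F 1 = F [:: 0%N].
Proof. by rewrite /permsum big_seq1. Qed.

Lemma cluster_sum0 : cluster_sum 0 = 0. Proof. exact: permsum_nil. Qed.
Lemma below_sum0 : below_sum 0 = 0. Proof. by rewrite /below_sum permsum_nil below_wt_nil. Qed.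
Lemma cluster_sum1 : cluster_sum 1 = 1. Proof. exact: permsum_single. Qed.

(** The first letter of a cluster is cut off from the rest. *)
Lemma cluster_sum_rec n : (0 < n)%N -> cluster_sum n.+1 = below_sum n - y * cluster_sum n.
Proof.
move=> n0; pose g w := below_wt y w - y * cluster y w 0.
have ginv : order_invariant g.
  by move=> w h uw hm; rewrite /g cluster_invariant // below_wt_invariant.
have oinv : order_invariant (fun _ : seq nat => 1 : R) by [].
transitivity (permsum (fun w => (cut 1 w)%:R * (1 * g (drop 1 w))) n.+1).
  apply: eq_permsum => w hw; have szw := perm_size hw; rewrite size_iota in szw.
  have uw : uniq w by rewrite (perm_uniq hw) iota_uniq.
  case: w szw uw {hw} => [|a w] // [szw] uw.
  rewrite mul1r cluster0_cons // /nilp szw -[n == 0%N]negbK -lt0n n0 /=.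
  by rewrite /cut [take _ _]/= take0 /= drop0 andbT.
rewrite (permsum_cut (f := fun=> 1)) // permsum_single mul1r subSS subn0.
by rewrite /permsum sumrB -mulr_sumr.
Qed.

Lemma below_sum_rec n : below_sum n = cluster_sum n + \sum_(1 <= p < n./2.+1)
  block_sign R p * y ^+ p * permsum (fun u => (linked u)%:R) p.*2 * below_sum (n - p.*2).
Proof.
transitivity (permsum (fun w => cluster y w 0 + block_sum y (block_sign R) w) n).
  by apply: eq_permsum => w hw; rewrite below_wtE // (perm_uniq hw) iota_uniq.
rewrite {1}/permsum big_split /=; congr (_ + _).
transitivity (\sum_(1 <= p < n./2.+1) permsum (fun w => block_sign R p * y ^+ p *
   ((cut p.*2 w)%:R * ((linked (take p.*2 w))%:R * below_wt y (drop p.*2 w)))) n).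
  rewrite /permsum exchange_big /= big_seq [RHS]big_seq; apply: eq_bigr => w.
  rewrite mem_permutations => hw; rewrite /block_sum (perm_size hw) size_iota.
  by apply: eq_bigr => p _; rewrite -mulnb natrM !mulrA.
rewrite !big_nat; apply: eq_bigr => p /andP[_ lt_p].
have le_pn : (p.*2 <= n)%N by lia.
rewrite -mulrA -(permsum_cut linked_invariant below_wt_invariant le_pn).
by rewrite /permsum -mulr_sumr.
Qed.

End Invariance.

(** * Splitting a word at its least letter *)

Definition lrmin w := (\sum_(j < size w) all (ltn (nth 0 w j)) (take j w))%N.

Lemma lrmin_cat_min u m v : all (ltn m) u -> all (ltn m) v ->
  lrmin (u ++ m :: v) = (lrmin u).+1.
Proof.
move=> hu hv; rewrite /lrmin size_cat /= -addn1 addnA addn1 addnC.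
rewrite -(big_mkord xpredT (fun j => all (ltn (nth 0%N (u ++ m :: v) j)) (take j (u ++ m :: v)) : nat)).
rewrite (@big_cat_nat _ _ _ (size u)) //=; last by lia.
rewrite [X in (_ + X)%N]big_ltn; last by lia.
rewrite nth_cat ltnn subnn /= take_size_cat // hu.
rewrite [X in (_ + (_ + X))%N]big_nat [X in (_ + (_ + X))%N]big1 => [|j /andP[lt_uj lt_j]]; last first.
  apply/eqP; rewrite eqb0; apply/negP => /allP/(_ m).
  rewrite nth_cat take_cat ltnNge (ltnW lt_uj) /= mem_cat.
  rewrite (_ : (j - size u = (j - size u).-1.+1)%N); last by lia.
  rewrite /= inE eqxx orbT => /(_ isT).
  have lt_v : ((j - size u).-1 < size v)%N by lia.
  have := mem_nth 0%N lt_v.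
  by move/(allP hv) => /=; lia.
rewrite addn0 addn1 big_mkord; congr _.+1; apply: eq_bigr => j _.
by rewrite nth_cat take_cat ltn_ord.
Qed.

Lemma lrmin_map (h : nat -> nat) w :
  {in w &, {mono h : a b / (a < b)%N}} -> lrmin (map h w) = lrmin w.
Proof.
move=> hm; rewrite /lrmin size_map; apply: eq_bigr => j _; congr nat_of_bool.
rewrite -map_take all_map (nth_map 0%N) //; apply: eq_in_all => z hz /=.
by rewrite hm ?mem_nth ?(mem_take hz).
Qed.

(** An occurrence starts with its least letter, so it cannot run from a into
    the lower letter m. *)
Lemma match_head_cat_min a u m v : all (ltn m) (a :: u) ->
  match_head (a :: u ++ m :: v) = match_head (a :: u).
Proof.
move=> /= /andP[lt_ma _].
by case: u => [|? [|? [|? [|? [|? u]]]]] //=; case: v => [|? [|? [|? [|? v]]]] //=;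
  apply/negbTE/negP => /and5P[]; lia.
Qed.

Section Min.
Variables (R : comNzRingType) (y x : R).

Lemma avoid_wt_cat_min u m v : all (ltn m) u ->
  avoid_wt y (u ++ m :: v) = (if nilp u then 1 else avoid_wt y u * y) * avoid_wt y (m :: v).
Proof.
elim: u => [|a u IH]; first by rewrite mul1r.
move=> hu; have /andP[lt_ma hu'] := hu; have := IH hu'.
have := match_head_cat_min v hu; case: u {IH hu hu'} => [|b u] mhE BE.
  by rewrite [_ ++ _]/= avoid_wt_cons mhE [(m < a)%N]lt_ma /= mulr1 [avoid_wt y [:: a]]/avoid_wt /= mul1r.
by rewrite [_ ++ _]/= !avoid_wt_cons mhE BE !mulrA.
Qed.

Definition lrmin_wt w : R := if nilp w then 1 else x ^+ lrmin w * (y * avoid_wt y w).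
(** The weight of the word 0 v up to order isomorphism: shifting v makes room
    for a new least letter. *)
Definition min_wt w : R := y * avoid_wt y (0%N :: map succn w).

Lemma lrmin_wt_cat_min u v : uniq v -> all (ltn 0) u -> all (ltn 0) v ->
  lrmin_wt (u ++ 0%N :: v) = lrmin_wt u * (x * min_wt v).
Proof.
move=> uv hu hv; rewrite {1}/lrmin_wt /nilp size_cat addnS /=.
have -> : min_wt v = y * avoid_wt y (0%N :: v).
  congr (_ * _); rewrite -(@avoid_wt_map _ _ (fun a => if a == 0%N then 0%N else a.+1) (0%N :: v)).
    congr (avoid_wt y (_ :: _)); apply/eq_in_map => a /(allP hv) /=.
    by case: a.
  by move=> a b _ _ /=; case: a => [|a]; case: b.
rewrite lrmin_cat_min // avoid_wt_cat_min // /lrmin_wt exprS.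
case: (boolP (nilp u)) => [/nilP->|_]; last by ring.
by rewrite /lrmin big_ord0; ring.
Qed.

Lemma lrmin_wt_invariant : order_invariant lrmin_wt.
Proof.
by move=> w h uw hm; rewrite /lrmin_wt /nilp size_map lrmin_map // avoid_wt_invariant.
Qed.

Lemma min_wt_invariant : order_invariant min_wt.
Proof.
move=> w h uw hm; congr (_ * _).
have -> : 0%N :: map succn (map h w)
    = map (fun a => if a is a'.+1 then (h a').+1 else 0%N) (0%N :: map succn w).
  by rewrite /= -!map_comp.
apply: avoid_wt_map => a b; rewrite !inE => /orP[/eqP->|/mapP[a' ha ->]] /orP[/eqP->|/mapP[b' hb ->]] //.
by rewrite !ltnS hm.
Qed.

Lemma invariant_split (f g : seq nat -> R) k : order_invariant f -> order_invariant g ->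
  order_invariant (fun w => f (take k w) * g (drop k w)).
Proof.
move=> finv ginv w h uw hm; rewrite -map_take -map_drop finv ?ginv ?take_uniq ?drop_uniq //.
  by move=> a b /mem_drop ha /mem_drop hb; apply: hm.
by move=> a b /mem_take ha /mem_take hb; apply: hm.
Qed.

(** The equation F' = x F G, coefficientwise. *)
Lemma permsum_lrmin_wt n : permsum lrmin_wt n.+1
  = x * \sum_(k < n.+1) 'C(n, k)%:R * (permsum lrmin_wt k * permsum min_wt (n - k)).
Proof.
have u0 : uniq (0%N :: iota 1 n) by apply: (iota_uniq 0 n.+1).
rewrite /permsum -[iota 0 n.+1]/(0%N :: iota 1 n) (permsum_insert _ u0) size_iota mulr_sumr.
apply: eq_bigr => k _; have le_kn : (k <= n)%N by rewrite -ltnS.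
rewrite -(permsum_split lrmin_wt_invariant min_wt_invariant le_kn).
have := permsum_seq (invariant_split k lrmin_wt_invariant min_wt_invariant) (iota_uniq 1 n).
rewrite size_iota => <-; rewrite mulr_sumr big_seq [RHS]big_seq; apply: eq_bigr => w.
rewrite mem_permutations => hw; have uw : uniq w by rewrite (perm_uniq hw) iota_uniq.
have w0 a : a \in w -> (0 < a)%N by rewrite (perm_mem hw) mem_iota => /andP[].
rewrite lrmin_wt_cat_min ?drop_uniq //; first by ring.
  by apply/allP => a /mem_take/w0.
by apply/allP => a /mem_drop/w0.
Qed.

(** With F_1 = 1 + y B, B the series on the left, and U = 1 - y K this is
    U F_1 = 1. *)
Lemma permsum_avoid_wt n : permsum (avoid_wt y) n = cluster_sum y n
  + y * \sum_(1 <= k < n) 'C(n, k)%:R * (cluster_sum y k * permsum (avoid_wt y) (n - k)).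
Proof.
rewrite {1}/permsum big_seq (eq_bigr (fun w => cluster y w 0
    + y * \sum_(1 <= k < n) cluster y (take k w) 0 * avoid_wt y (drop k w))) => [|w]; last first.
  rewrite mem_permutations => /perm_size; rewrite size_iota => szw.
  case: w szw => [<-|a w szw]; first by rewrite big_geq // mulr0 addr0.
  by rewrite -szw -avoid_wt_cluster // szw.
rewrite -big_seq big_split /= -/(cluster_sum y n) -mulr_sumr exchange_big /=.
congr (_ + y * _); rewrite !big_nat; apply: eq_bigr => k /andP[_ lt_kn].
by rewrite -(permsum_split (cluster_invariant y 0) (avoid_wt_invariant y) (ltnW lt_kn)).
Qed.

End Min.

(** * From permutations to words *)

Definition descents w := (\sum_(i < size w) ((i.+1 < size w) && (nth 0 w i.+1 < nth 0 w i)))%N.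
Definition avoid w := all (fun i => ~~ match_head (drop i w)) (iota 0 (size w)).

Lemma avoid_cons a w : avoid (a :: w) = ~~ match_head (a :: w) && avoid w.
Proof.
rewrite /avoid -[iota 0 _]/(0%N :: iota (1 + 0) (size w)) iotaDl /= all_map.
by congr (_ && _); apply: eq_all => i.
Qed.

Lemma avoid_wtE (R : comNzRingType) (y : R) w : ~~ nilp w ->
  avoid_wt y w = (avoid w)%:R * y ^+ descents w.
Proof.
elim: w => // a [|b w] IH _.
  rewrite /avoid_wt /descents big_ord_recl big_ord0 /=.
  by rewrite /avoid /= expr0 mulr1.
rewrite avoid_wt_cons IH // [avoid (a :: _)]avoid_cons -[in RHS]mulnb natrM.
have -> : descents [:: a, b & w] = ((b < a) + descents (b :: w))%N.
  by rewrite /descents [size [:: a, b & w]]/= big_ord_recl.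
by rewrite exprD; ring.
Qed.

Section Bridge.
Variable n : nat.
Implicit Types s : 'S_n.

Lemma size_word s : size (word s) = n.
Proof. by rewrite size_map size_enum_ord. Qed.

Lemma nth_word s (i : 'I_n) : nth 0%N (word s) i = (s i).+1.
Proof. by rewrite (nth_map i) ?size_enum_ord // nth_ord_enum. Qed.

Lemma uniq_word s : uniq (word s).
Proof. by rewrite map_inj_uniq ?enum_uniq // => i j [/val_inj/perm_inj]. Qed.

Lemma desE s : des s = descents (word s).
Proof.
rewrite /des /descents size_word -sum1_card big_mkcond /=; apply: eq_bigr => i _.
rewrite inE; case: existsP => [[j /andP[/eqP hj lt_s]]|hN].
  by rewrite -hj ltn_ord !nth_word ltnS lt_s.
case: ltnP => //= lt_i; rewrite -[i.+1]/(val (Ordinal lt_i)) !nth_word ltnS.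
by case: ltnP => // lt_s; case: hN; exists (Ordinal lt_i); rewrite eqxx.
Qed.

Lemma LRminE s : LRmin s = lrmin (word s).
Proof.
rewrite /LRmin /lrmin size_word -sum1_card big_mkcond /=; apply: eq_bigr => j _.
rewrite inE; have szt : size (take j (word s)) = j by rewrite size_takel // size_word ltnW.
have -> : all (ltn (nth 0%N (word s) j)) (take j (word s))
    = [forall i : 'I_n, (i < j) ==> (s j < s i)]%N; last by case: ifP.
apply/(all_nthP 0%N)/forallP => [h i|h i].
  by apply/implyP => lt_ij; have := h i; rewrite szt nth_take // !nth_word => /(_ lt_ij).
rewrite szt => lt_ij; rewrite nth_take // -[i]/(val (Ordinal (ltn_trans lt_ij (ltn_ord j)))).
by rewrite !nth_word; have /implyP := h (Ordinal (ltn_trans lt_ij (ltn_ord j))); apply.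
Qed.

Lemma perm_word : perm_eq [seq word s | s : 'S_n] (permutations (iota 1 n)).
Proof.
have uw : uniq [seq word s | s : 'S_n].
  rewrite map_inj_uniq ?enum_uniq // => s t e; apply/permP => i; apply/val_inj.
  by have := congr1 (fun w => nth 0%N w i) e; rewrite !nth_word => -[].
apply: uniq_perm; rewrite ?permutations_uniq //.
suff sub : {subset [seq word s | s : 'S_n] <= permutations (iota 1 n)}.
  have [|] := uniq_min_size uw sub => //.
  by rewrite size_permutations ?iota_uniq // size_iota size_map -cardE card_Sn.
move=> _ /mapP[s _ ->]; rewrite mem_permutations; apply: uniq_perm.
- exact: uniq_word.
- exact: iota_uniq.
move=> a; rewrite mem_iota add1n; apply/mapP/idP => [[i _ ->]|/andP[a0 lt_an]].
  by rewrite !ltnS /=.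
have lt_a : (a.-1 < n)%N by rewrite -ltnS prednK.
by exists (s^-1 (Ordinal lt_a))%g; rewrite ?mem_enum // permKV /= prednK.
Qed.

End Bridge.

Local Notation tau := [:: 1; 4; 2; 5; 3; 6]%N.

Lemma red_tau (w : seq nat) : uniq w -> size w = 6 -> (red w == tau) = match_head w.
Proof.
move: w => [|a [|b [|c [|d [|e [|f []]]]]]] // uw _.
set w := [:: a; b; c; d; e; f] in uw *; set s := sort leq w.
have ss : sorted leq s by apply: sort_sorted; apply: leq_total.
have sw : s =i w by move=> z; rewrite mem_sort.
have us : uniq s by rewrite sort_uniq.
have lt_s z t : z \in w -> t \in w -> (index z s < index t s)%N -> (z < t)%N.
  move=> hz ht lt_i; rewrite ltn_neqAle; apply/andP; split.
    by apply: contraTneq lt_i => ->; rewrite ltnn.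
  by apply: (sorted_leq_index leq_trans leqnn ss); rewrite ?sw // ltnW.
apply/eqP/idP.
  rewrite /red /= -/w -/s => -[ha hb hc hd he hf].
  by apply/and5P; split; apply: lt_s; rewrite ?ha ?hb ?hc ?hd ?he ?hf // !inE eqxx ?orbT.
move=> /and5P[h1 h2 h3 h4 h5].
have sE : s = [:: a; c; e; b; d; f].
  apply: (sorted_eq leq_trans anti_leq) => //.
    by rewrite /= (ltnW h1) (ltnW h2) (ltnW h3) (ltnW h4) (ltnW h5).
  rewrite perm_sort; apply/seq.permP => P /=; lia.
rewrite /red -/s sE /= !eqxx.
by rewrite !ltn_eqF //; lia.
Qed.

Lemma match_at_head (w : seq nat) i : uniq w -> match_at tau w i = match_head (drop i w).
Proof.
move=> uw; have red_take k : size (take k (drop i w)) = 6 ->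
    (red (take k (drop i w)) == tau) = match_head (take k (drop i w)).
  by apply: red_tau; rewrite take_uniq // drop_uniq.
apply/existsP/idP => [[j /andP[_ /eqP hj]]|h6].
  have sz6 : size (take (j.+1 - i) (drop i w)) = 6.
    by have := congr1 size hj; rewrite size_map.
  by move/eqP: hj; rewrite red_take // match_head_take => /andP[].
have lt_j : (i + 5 < size w)%N by have := match_head_size h6; rewrite size_drop; lia.
exists (Ordinal lt_j); rewrite /= -addnS addKn red_take.
  by rewrite match_head_take h6 -[X in (X < _)%N]addn0 ltn_add2l.
by rewrite size_takel // size_drop; lia.
Qed.

Lemma NM_setE n (s : 'S_n) : (s \in NM_set tau n) = avoid (word s).
Proof.
rewrite inE negb_exists; apply/forallP/allP => h i.
  rewrite size_word mem_iota /= => lt_in.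
  by have := h (Ordinal lt_in); rewrite match_at_head // uniq_word.
rewrite match_at_head ?uniq_word //; apply: h.
by rewrite size_word mem_iota /= ltn_ord.
Qed.

Lemma NM_polyE n : NM_poly tau n = permsum (lrmin_wt yvar xvar) n.
Proof.
case: n => [|n]; first by rewrite permsum_nil.
rewrite -{2}[n.+1](size_iota 1) -(permsum_seq (lrmin_wt_invariant _ _) (iota_uniq _ _)).
rewrite -(perm_big _ (perm_word n.+1)) big_image /= big_mkcond; apply: eq_bigr => s _.
have nil_s : ~~ nilp (word s) by rewrite /nilp size_word.
rewrite NM_setE /lrmin_wt (negbTE nil_s) avoid_wtE // LRminE desE exprD expr1.
by case: (avoid _); rewrite ?(mul1r, mul0r, mulr0).
Qed.

(** * Hessenberg determinants *)

Section Hessenberg.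
Variable R : comNzRingType.
Variables a b : nat -> R.

(** A free first row makes the expansion along the first column recursive:
    it only shifts that row.  The last column has its own Toeplitz symbol b. *)
Definition hess (r : nat -> R) k : 'M[R]_k := \matrix_(i < k, j < k)
  if i == 0 :> nat then r j
  else if (i <= j)%N then (if j.+1 == k :> nat then b (j - i) else a (j - i))
  else if i == j.+1 :> nat then -1 else 0.

(** With this first row, [hess] is Toeplitz apart from its last column. *)
Definition hrow k j := if j.+1 == k :> nat then b j else a j.

Definition hdet k := \det (hess (hrow k) k).

Lemma det_hess_rec r k :
  \det (hess r k.+2) = r 0%N * hdet k.+1 + \det (hess (fun j => r j.+1) k.+1).
Proof.
rewrite (expand_det_col _ ord0) big_ord_recl big_ord_recl big1 ?addr0; last first.
  by move=> i _; rewrite mxE /= mul0r.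
rewrite !mxE /= mulN1r /cofactor /= expr0 mul1r expr1 mulN1r opprK.
congr (_ * _ + _); rewrite /hdet; congr (\det _); apply/matrixP => i j; rewrite !mxE /=.
  rewrite /bump /hrow leq0n !add1n subSS !eqSS ltnS.
  by case: (val i) => [|i']; rewrite /= ?subn0.
rewrite /bump leq0n add1n; by case: i => -[|i] lt_ik.
Qed.

Lemma det_hess1 r : \det (hess r 1) = r 0%N.
Proof. by rewrite det_mx11 mxE. Qed.

Lemma det_hess r k :
  \det (hess r k.+1) = \sum_(j < k) r j * hdet (k - j) + r k.
Proof.
elim: k r => [|k IH] r; first by rewrite det_hess1 big_ord0 add0r.
by rewrite det_hess_rec IH big_ord_recl addrA.
Qed.

Lemma hdet_rec k : hdet k.+1 = \sum_(j < k) a j * hdet (k - j) + b k.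
Proof.
rewrite {1}/hdet det_hess /hrow eqxx; congr (_ + _); apply: eq_bigr => j _.
by rewrite eqSS ltn_eqF.
Qed.

End Hessenberg.

Lemma det_Mmx k :
  \det (Mmx k) = hdet (fun d => catalan (3 * d + 2)) (fun d => catalan (3 * d + 2)) k.
Proof.
congr (\det _); apply/matrixP => i j; rewrite !mxE /hrow.
by case: (val i) => [|i'] /=; rewrite ?subn0; do ?case: ifP.
Qed.

Lemma det_Pmx k :
  \det (Pmx k) = hdet (fun d => catalan (3 * d + 2)) (fun d => catalan (3 * d + 1)) k.
Proof.
congr (\det _); apply/matrixP => i j; rewrite !mxE /hrow.
have := ltn_ord i; case: (val i) => [|i'] lt_ik /=; rewrite ?subn0; first by case: ifP.
by case: ifP => // /eqP ejk; have -> : (i' < j)%N by lia.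
Qed.

(** * Formal power series *)

Section Fps.
Variable R : comUnitRingType.
Implicit Types F G H : nat -> R.

Definition trunc N F : {poly R} := \poly_(i < N) F i.
Definition fps_add F G : nat -> R := fun n => F n + G n.
Definition fps_scale (c : R) F : nat -> R := fun n => c * F n.
Definition fps_deriv F : nat -> R := fun n => n.+1%:R * F n.+1.

Lemma coef_trunc N F i : (i < N)%N -> (trunc N F)`_i = F i.
Proof. by move=> lt_iN; rewrite coef_poly lt_iN. Qed.

(** Coefficients of products are polynomial coefficients, which transfers
    associativity and the product rule from polynomials. *)
Lemma fps_mul_trunc N F G n : (n < N)%N -> fps_mul F G n = (trunc N F * trunc N G)`_n.
Proof.
move=> lt_nN; rewrite coefM; apply: eq_bigr => i _.
have := ltn_ord i; rewrite ltnS => le_in.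
by rewrite !coef_trunc // ?(leq_ltn_trans le_in) // (leq_ltn_trans (leq_subr _ _)).
Qed.

Lemma fps_mulC F G : fps_mul F G = fps_mul G F.
Proof.
by apply: functional_extensionality => n; rewrite !(fps_mul_trunc _ _ (ltnSn n)) mulrC.
Qed.

Lemma fps_mulA F G H : fps_mul F (fps_mul G H) = fps_mul (fps_mul F G) H.
Proof.
apply: functional_extensionality => n; set N := n.+1.
transitivity ((trunc N F * (trunc N G * trunc N H))`_n).
  rewrite coefM; apply: eq_bigr => i _; rewrite coef_trunc // -fps_mul_trunc //.
  by rewrite ltnS leq_subr.
rewrite mulrA coefM; apply: eq_bigr => i _.
by rewrite -fps_mul_trunc // coef_trunc // ltnS leq_subr.
Qed.

Lemma fps_mul1l F : fps_mul (fps_one R) F = F.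
Proof.
apply: functional_extensionality => n.
rewrite /fps_mul big_ord_recl big1 ?addr0 ?subn0 ?mul1r // => i _.
by rewrite /fps_one mul0r.
Qed.

Lemma fps_mulDr F G H : fps_mul F (fps_add G H) = fps_add (fps_mul F G) (fps_mul F H).
Proof.
apply: functional_extensionality => n; rewrite /fps_add /fps_mul -big_split.
by apply: eq_bigr => i _; rewrite mulrDr.
Qed.

Lemma fps_mulZr c F G : fps_mul F (fps_scale c G) = fps_scale c (fps_mul F G).
Proof.
apply: functional_extensionality => n; rewrite /fps_scale /fps_mul mulr_sumr.
by apply: eq_bigr => i _; rewrite mulrCA.
Qed.

Lemma fps_derivM F G :
  fps_deriv (fps_mul F G) = fps_add (fps_mul (fps_deriv F) G) (fps_mul F (fps_deriv G)).
Proof.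
apply: functional_extensionality => n; set N := n.+2.
have dT H i : (i <= n)%N -> (trunc N H)^`()`_i = fps_deriv H i.
  by move=> le_in; rewrite coef_deriv coef_trunc // -mulr_natl.
transitivity (((trunc N F * trunc N G)^`())`_n).
  by rewrite coef_deriv -fps_mul_trunc // -mulr_natl.
rewrite derivM coefD /fps_add; congr (_ + _); rewrite coefM; apply: eq_bigr => i _.
  by rewrite dT -1?ltnS // coef_trunc // /N; lia.
by rewrite dT ?leq_subr // coef_trunc //; apply: ltnW (ltn_ord i).
Qed.

Lemma fps_deriv_pow G m : fps_deriv (fps_pow G m.+1)
  = fps_scale m.+1%:R (fps_mul (fps_pow G m) (fps_deriv G)).
Proof.
elim: m => [|m IH].
  apply: functional_extensionality => n; rewrite /fps_scale mul1r /= fps_mul1l.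
  by rewrite fps_mulC fps_mul1l.
rewrite -[fps_pow G m.+2]/(fps_mul G (fps_pow G m.+1)) fps_derivM IH fps_mulZr fps_mulA.
rewrite -[fps_mul G (fps_pow G m)]/(fps_pow G m.+1) [fps_mul (fps_deriv G) _]fps_mulC.
by apply: functional_extensionality => n; rewrite /fps_add /fps_scale -[m.+2%:R]nat1r; ring.
Qed.

(** The chain rule. *)
Lemma fps_deriv_comp a G : G 0%N = 0 ->
  fps_deriv (fps_comp a G) = fps_mul (fps_comp (fps_deriv a) G) (fps_deriv G).
Proof.
move=> G0; apply: functional_extensionality => n.
transitivity (\sum_(m < n.+1) \sum_(i < n.+1)
    fps_deriv a m * (fps_pow G m i * fps_deriv G (n - i)%N)).
  rewrite {1}/fps_deriv /fps_comp big_ord_recl mulrDr.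
  rewrite {1}/fps_pow /= /fps_one /= mulr0 mulr0 add0r mulr_sumr.
  apply: eq_bigr => m _; rewrite /bump leq0n add1n mulrCA.
  have := congr1 (fun F => F n) (fps_deriv_pow G m); rewrite {1}/fps_deriv /fps_scale => ->.
  by rewrite mulr_sumr mulr_sumr; apply: eq_bigr => i _; rewrite /fps_deriv; ring.
rewrite exchange_big; apply: eq_bigr => i _; rewrite /fps_comp.
rewrite (big_ord_widen n.+1 (fun m => fps_deriv a m * fps_pow G m i)) ?ltn_ord //.
rewrite mulr_suml [RHS]big_mkcond; apply: eq_bigr => m _; rewrite mulrA.
by case: ltnP => // lt_im; rewrite fps_pow_small // mulr0 mul0r.
Qed.

Lemma fps_comp0 a G : fps_comp a G 0%N = a 0%N.
Proof. by rewrite /fps_comp big_ord1 mulr1. Qed.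

Hypothesis natr_unit : forall m, (m.+1%:R : R) \is a GRing.unit.

Lemma fact_unit m : (m`!%:R : R) \is a GRing.unit.
Proof. by rewrite -(prednK (fact_gt0 m)) natr_unit. Qed.

Lemma fps_deriv_exp H : H 0%N = 0 ->
  fps_deriv (fps_exp H) = fps_mul (fps_exp H) (fps_deriv H).
Proof.
move=> H0; rewrite /fps_exp fps_deriv_comp //; congr (fps_mul (fps_comp _ _) _).
apply: functional_extensionality => m; rewrite /fps_deriv factS natrM.
by rewrite invrM ?natr_unit ?fact_unit // mulrCA divrr ?mulr1 ?natr_unit.
Qed.

Lemma fps_pow_opp G m : fps_pow (fun n => - G n) m = fps_scale ((-1) ^+ m) (fps_pow G m).
Proof.
elim: m => [|m IH]; first by apply: functional_extensionality => n; rewrite /fps_scale mul1r.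
rewrite -[fps_pow _ m.+1]/(fps_mul (fun n => - G n) (fps_pow (fun n => - G n) m)) IH fps_mulZr.
apply: functional_extensionality => n; rewrite /fps_scale exprS mulN1r mulNr -mulrN.
congr (_ * _); rewrite -[fps_pow G m.+1]/(fps_mul G (fps_pow G m)) /fps_mul -sumrN.
by apply: eq_bigr => i _; rewrite mulNr.
Qed.

Lemma fps_deriv_log F : F 0%N = 1 ->
  fps_deriv (fps_log F) = fps_mul (fps_inv F) (fps_deriv F).
Proof.
move=> F0; rewrite /fps_log fps_deriv_comp; last by rewrite F0 subrr.
congr fps_mul; last first.
  by apply: functional_extensionality => n; rewrite /fps_deriv /fps_one subr0.
apply: functional_extensionality => n; apply: eq_bigr => m _.
have -> : (fun n => fps_one R n - F n) = (fun n => - (F n - fps_one R n)).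
  by apply: functional_extensionality => i; rewrite opprB.
rewrite fps_pow_opp /fps_scale mul1r; congr (_ * _).
by rewrite /fps_deriv mulrCA divrr ?mulr1 ?natr_unit.
Qed.

Lemma fps_deriv_rpow F x : F 0%N = 1 -> fps_deriv (fps_rpow F x)
  = fps_scale x (fps_mul (fps_rpow F x) (fps_mul (fps_inv F) (fps_deriv F))).
Proof.
move=> F0; have log0 : fps_log F 0%N = 0 by rewrite /fps_log fps_comp0.
rewrite /fps_rpow fps_deriv_exp ?log0 ?mulr0 // -fps_deriv_log // -fps_mulZr.
congr fps_mul; apply: functional_extensionality => n.
by rewrite /fps_deriv /fps_scale mulrCA.
Qed.

(** The equation determines each coefficient from the earlier ones, as
    positive integers are units. *)
Lemma fps_ode_unique c F G H : F 0%N = G 0%N ->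
  fps_deriv F = fps_scale c (fps_mul F H) -> fps_deriv G = fps_scale c (fps_mul G H) -> F = G.
Proof.
move=> FG0 dF dG; apply: functional_extensionality; elim/ltn_ind => -[//|n] IH.
apply: (mulrI (natr_unit n)).
have := congr1 (fun F => F n) dF; have := congr1 (fun F => F n) dG.
rewrite /fps_deriv => -> ->; congr (_ * _); apply: eq_bigr => i _.
by rewrite IH.
Qed.

Lemma egf_mul a b : fps_mul (egf a) (egf b)
  = egf (fun n => \sum_(k < n.+1) 'C(n, k)%:R * (a k * b (n - k)%N)) :> (nat -> R).
Proof.
apply: functional_extensionality => n; rewrite /egf mulr_suml; apply: eq_bigr => k _.
have le_kn : (k <= n)%N by rewrite -ltnS.
have -> : (n`!%:R : R) = 'C(n, k)%:R * (k`!%:R * (n - k)`!%:R) by rewrite -!natrM bin_fact.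
have unit_kf : (k`!%:R * (n - k)`!%:R : R) \is a GRing.unit by rewrite unitrM !fact_unit.
have unit_bin : ('C(n, k)%:R : R) \is a GRing.unit.
  by rewrite -(prednK (_ : 0 < 'C(n, k))%N) ?bin_gt0 // natr_unit.
rewrite invrM // [(k`!%:R * _)^-1]invrM ?fact_unit //.
transitivity (('C(n, k)%:R / 'C(n, k)%:R) * (a k * b (n - k)%N * ((n - k)`!%:R^-1 / k`!%:R))).
  by rewrite divrr // mul1r; ring.
by ring.
Qed.

Lemma fps_deriv_egf a : fps_deriv (egf a) = egf (fun n => a n.+1) :> (nat -> R).
Proof.
apply: functional_extensionality => n; rewrite /fps_deriv /egf factS natrM.
by rewrite invrM ?natr_unit ?fact_unit // mulrCA [_%:R * _]mulrCA divrr ?mulr1 ?natr_unit.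
Qed.

Lemma fps_inv_eq F G : F 0%N = 1 -> fps_mul F G = fps_one R -> fps_inv F = G.
Proof.
move=> F0 FG; have FV : fps_mul F (fps_inv F) = fps_one R.
  by apply: functional_extensionality => n; apply: fps_mulV.
by rewrite -[fps_inv F]fps_mul1l -FG [fps_mul F G]fps_mulC -fps_mulA FV fps_mulC fps_mul1l.
Qed.

End Fps.

(** * Eliminating the auxiliary sums *)

Lemma sum_multiples (V : nmodType) (H : nat -> V) d N : (0 < d)%N ->
  \sum_(i < N) (if (d %| i)%N then H (i %/ d)%N else 0)
  = \sum_(k < N) (if (d * k < N)%N then H k else 0).
Proof.
move=> d0; transitivity (\sum_(i < N) \sum_(k < N) (if i == d * k :> nat then H k else 0)).
  apply: eq_bigr => i _; rewrite -big_mkcond /=; case: ifP => [/dvdnP[q hq]|ndvd].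
    rewrite hq mulnK // (eq_bigl (fun k : 'I_N => k == q :> nat)) => [|k].
      rewrite (big_ord1_eq _ H) (_ : (q < N)%N) //.
      by apply: leq_ltn_trans (ltn_ord i); rewrite hq leq_pmulr.
    by rewrite mulnC eqn_pmul2l // eq_sym.
  rewrite big_pred0 // => k; apply/negP => /eqP ik.
  by rewrite ik dvdn_mulr in ndvd.
rewrite exchange_big; apply: eq_bigr => k _.
by rewrite -big_mkcond (big_ord1_eq _ (fun=> H k)).
Qed.

Section Series.
Variables (R : comUnitRingType) (y : R) (phi : {rmorphism rat -> R}).
Implicit Types (a : nat -> rat) (F : nat -> R).

(** The substitution of y^3 z^6 for the variable of a rational power
    series. *)
Definition spread a : nat -> R :=
  fun n => if (6 %| n)%N then phi (a (n %/ 6)%N) * y ^+ (3 * (n %/ 6)) else 0.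

(** Multiplication of F by z^c. *)
Definition delay c F : nat -> R := fun n => if (c <= n)%N then F (n - c)%N else 0.

Lemma delay0 F n : delay 0 F n = F n.
Proof. by rewrite /delay subn0. Qed.

Lemma delay_add c d F : delay c (delay d F) = delay (d + c) F.
Proof.
apply: functional_extensionality => n; rewrite /delay.
case: leqP => hc; last by rewrite leqNgt (leq_trans hc) ?leq_addl.
by rewrite leq_subRL // addnC -subnDA addnC.
Qed.

Lemma fps_mul_spread a F L n : (n < L)%N ->
  fps_mul (spread a) F n = \sum_(k < L) phi (a k) * y ^+ (3 * k) * delay (6 * k) F n.
Proof.
move=> lt_nL; transitivity (\sum_(i < n.+1)
    (if (6 %| i)%N then phi (a (i %/ 6)%N) * y ^+ (3 * (i %/ 6)) * F (n - 6 * (i %/ 6))%N else 0)).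
  apply: eq_bigr => i _; rewrite /spread; case: ifP => [dvd6|_]; last by rewrite mul0r.
  by rewrite [(6 * (i %/ 6))%N]mulnC divnK.
rewrite (sum_multiples (fun k => phi (a k) * y ^+ (3 * k) * F (n - 6 * k)%N)) //.
rewrite (big_ord_widen L (fun k => if (6 * k < n.+1)%N
  then phi (a k) * y ^+ (3 * k) * F (n - 6 * k)%N else 0)) //.
rewrite big_mkcond; apply: eq_bigr => k _; rewrite /delay [(6 * k < _)%N]ltnS.
case: (leqP (6 * k) n) => [le_6k|_]; first by rewrite ifT //; lia.
by rewrite mulr0; case: ifP.
Qed.

Lemma spread_mul a b : fps_mul (spread a) (spread b) = spread (fps_mul a b).
Proof.
apply: functional_extensionality => n; rewrite (fps_mul_spread _ _ (ltnSn n)).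
rewrite {2}/spread; case: ifP => [/dvdnP[q ->]|ndvd]; last first.
  rewrite big1 // => k _; rewrite /delay /spread; case: leqP; rewrite ?mulr0 // => le_6k.
  by rewrite dvdn_subl ?ndvd ?mulr0 // dvdn_mulr.
rewrite mulnK // /fps_mul rmorph_sum mulr_suml.
rewrite (big_ord_widen (q * 6).+1 (fun i => phi (a i * b (q - i)%N) * y ^+ (3 * q))); last by lia.
rewrite [RHS]big_mkcond; apply: eq_bigr => k _; rewrite /delay /spread ltnS.
have -> : (6 * k <= q * 6)%N = (k <= q)%N by lia.
case: leqP => le_kq; last by rewrite mulr0.
have -> : (q * 6 - 6 * k)%N = ((q - k) * 6)%N by lia.
rewrite dvdn_mull // mulnK // rmorphM.
have -> : (3 * q = 3 * k + 3 * (q - k))%N by lia.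
by rewrite exprD; ring.
Qed.

Lemma spread_one : spread (fps_one _) = fps_one R.
Proof.
apply: functional_extensionality => n; rewrite /spread /fps_one.
case: ifP => [/dvdnP[q ->]|h].
  by rewrite mulnK // muln_eq0 orbF; case: q => [|q]; rewrite /= ?rmorph1 ?rmorph0 ?mul0r ?mul1r.
by case: n h.
Qed.

Definition cat2 d := catalan (3 * d + 2).
Definition cat1 d := catalan (3 * d + 1).
Definition one_sub_cat2 n : rat := if n is n'.+1 then - cat2 n' else 1.
Definition mdet := hdet cat2 cat2.
Definition pdet n := hdet cat2 cat1 n.+1.

(** The recursion of the determinants of M, with index 0 for the empty
    matrix, says that their series is the inverse of [one_sub_cat2]. *)
Lemma one_sub_cat2_mdet : fps_mul one_sub_cat2 mdet = fps_one _.
Proof.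
have m0 : mdet 0 = 1 by apply: det_mx00.
apply: functional_extensionality => -[|n].
  by rewrite /fps_mul big_ord1 mul1r.
rewrite /fps_mul big_ord_recl mul1r subn0 {1}/mdet hdet_rec big_ord_recr /=.
rewrite /bump /= !add1n subSS subnn m0 mulr1 -/mdet addrACA subrr addr0.
by rewrite -big_split big1 // => i _ /=; rewrite /bump /= subSS mulNr subrr.
Qed.

Lemma one_sub_cat2_pdet : fps_mul one_sub_cat2 pdet = cat1.
Proof.
apply: functional_extensionality => n.
rewrite /fps_mul big_ord_recl mul1r subn0 {1}/pdet hdet_rec addrAC -big_split big1 ?add0r //.
move=> i _ /=; rewrite /bump /= add1n /pdet -[in X in _ + X]subSn // subSS mulNr.
by rewrite subrr.
Qed.

Local Notation cluster_sum := (cluster_sum y).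
Local Notation below_sum := (below_sum y).

Lemma block_sign_mod3 k :
  [/\ block_sign R (3 * k) = 1, block_sign R (3 * k).+1 = 0 & block_sign R (3 * k).+2 = -1].
Proof.
elim: k => [|k [_ h1 h2]]; first by rewrite /= addr0.
have fsS p : block_sign R p.+2 = - (block_sign R p + block_sign R p.+1) by [].
rewrite mulnS -[(3 + _)%N]/(3 * k).+3.
have e0 : block_sign R (3 * k).+3 = 1 by rewrite fsS h1 h2 add0r opprK.
have e1 : block_sign R (3 * k).+4 = 0 by rewrite fsS h2 e0 addNr oppr0.
by split; rewrite // fsS e0 e1 addr0.
Qed.

Lemma sum_by3 (T : nat -> R) N :
  \sum_(p < 3 * N) T p = \sum_(k < N) (T (3 * k)%N + T (3 * k).+1 + T (3 * k).+2).
Proof.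
elim: N => [|N IH]; first by rewrite muln0 !big_ord0.
rewrite [RHS]big_ord_recr /= -IH mulnS -[(3 + _)%N]/(3 * N).+3.
by rewrite !big_ord_recr /= !addrA.
Qed.

(** [below_sum_rec] with its terms sorted by p modulo 3: the signs are 1, 0,
    -1 and p = 3k contributes to [one_sub_cat2], p = 3k+2 to [cat1]. *)
Lemma below_sum_series :
  fps_add (fps_mul (spread one_sub_cat2) below_sum)
          (fps_scale (y ^+ 2) (fps_mul (spread cat1) (delay 4 below_sum)))
  = cluster_sum.
Proof.
apply: functional_extensionality => n; rewrite /fps_add /fps_scale.
pose T p : R := if p is p'.+1 then
  block_sign R p * y ^+ p * phi (catalan p') * delay p.*2 below_sum n else 0.
have JT : below_sum n = cluster_sum n + \sum_(k < n.+1) (T (3 * k)%N + T (3 * k).+1 + T (3 * k).+2).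
  rewrite below_sum_rec -sum_by3 -(big_mkord xpredT T) big_ltn // add0r; congr (_ + _).
  rewrite (@big_cat_nat _ _ _ n./2.+1 1 (3 * n.+1)) //=; last by lia.
  rewrite [X in _ = _ + X]big_nat [X in _ = _ + X]big1 ?addr0 => [|p /andP[hp _]].
    rewrite !big_nat; apply: eq_bigr => -[|p] // /andP[_ hp].
    rewrite permsum_linked /T /delay (_ : (p.+1.*2 <= n)%N); last by lia.
    by rewrite catalanE rmorphB !rmorph_nat.
  case: p hp => // p hp; rewrite /T /delay leqNgt (_ : (n < p.+1.*2)%N) ?mulr0 //; lia.
have e1 : fps_mul (spread one_sub_cat2) below_sum n = below_sum n - \sum_(k < n.+1) T (3 * k)%N.
  rewrite (fps_mul_spread _ _ (ltnSn n)) !big_ord_recl rmorph1 !muln0 expr0 !mul1r delay0.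
  rewrite [T 0]/= add0r -sumrN.
  congr (_ + _); apply: eq_bigr => k _; rewrite !lift0.
  have [f0 _ _] := block_sign_mod3 k.+1.
  have -> : T (3 * k.+1)%N = y ^+ (3 * k.+1) * phi (cat2 k) * delay (6 * k.+1) below_sum n.
    rewrite (_ : 3 * k.+1 = (3 * k + 2).+1)%N in f0 *; last by lia.
    by rewrite /T f0 mul1r (_ : (3 * k + 2).+1.*2 = 6 * k.+1)%N //; lia.
  by rewrite rmorphN; ring.
have e2 : y ^+ 2 * fps_mul (spread cat1) (delay 4 below_sum) n = - \sum_(k < n.+1) T (3 * k).+2.
  rewrite (fps_mul_spread _ _ (ltnSn n)) mulr_sumr -sumrN; apply: eq_bigr => k _.
  have [_ _ f2] := block_sign_mod3 k; rewrite delay_add /T f2 -[(3 * k).+1]addn1 -/(cat1 k).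
  rewrite (_ : (3 * k + 1).+1.*2 = 4 + 6 * k)%N; last by lia.
  have -> : y ^+ (3 * k + 1).+1 = y ^+ 2 * y ^+ (3 * k) by rewrite -exprD; congr (_ ^+ _); lia.
  by ring.
have T1 : \sum_(k < n.+1) T (3 * k).+1 = 0.
  by rewrite big1 // => k _; have [_ f1 _] := block_sign_mod3 k; rewrite /T f1 !mul0r.
rewrite e1 e2 JT !big_split /= T1; ring.
Qed.

(** Multiply by the inverse of [one_sub_cat2]. *)
Lemma below_sum_det n :
  below_sum n + y ^+ 2 * fps_mul (spread pdet) (delay 4 below_sum) n
  = fps_mul (spread mdet) cluster_sum n.
Proof.
rewrite -below_sum_series fps_mulDr fps_mulZr !fps_mulA !spread_mul.
rewrite [fps_mul mdet one_sub_cat2]fps_mulC one_sub_cat2_mdet spread_one fps_mul1l.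
have -> : fps_mul mdet cat1 = pdet.
  by rewrite -one_sub_cat2_pdet fps_mulA [fps_mul mdet one_sub_cat2]fps_mulC one_sub_cat2_mdet fps_mul1l.
by [].
Qed.

(** The bracket in the second sum is a value of [below_sum], by
    [cluster_sum_rec].  The index ranges leave out only the terms with
    [cluster_sum] or [below_sum] at 0, which vanish. *)
Lemma cluster_sum_detE n : (2 <= n)%N ->
  cluster_sum n = (1 - y) * cluster_sum (n - 1)
    + \sum_(k < n | (6 * k + 8 <= n)%N)
        phi (\det (Mmx k.+1)) * y ^+ (3 * k + 3) * cluster_sum (n - (6 * k + 7))
    - \sum_(k < n | (6 * k + 6 <= n)%N)
        phi (\det (Pmx k.+1)) * y ^+ (3 * k + 2)
          * (cluster_sum (n - (6 * k + 4)) + y * cluster_sum (n - (6 * k + 5))).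
Proof.
case: n => // n n0; rewrite subSS subn0 cluster_sum_rec //.
have := below_sum_det n; rewrite (fps_mul_spread mdet _ (leqnSn n.+1)) => /(canRL (addrK _)) ->.
rewrite (fps_mul_spread pdet _ (ltnSn n)) big_ord_recl [mdet _]det_mx00 rmorph1 !muln0.
rewrite expr0 !mul1r delay0 mulr_sumr.
set SM := \sum_(k < n.+1) _; set SP := \sum_(k < n.+1) _.
have -> : SM = \sum_(k < n.+1 | (6 * k + 8 <= n.+1)%N)
        phi (\det (Mmx k.+1)) * y ^+ (3 * k + 3) * cluster_sum (n.+1 - (6 * k + 7)).
  rewrite [RHS]big_mkcond; apply: eq_bigr => k _; rewrite lift0 det_Mmx -/cat2 -/mdet /delay.
  rewrite mulnSr; case: (leqP (6 * k + 8) n.+1) => hk.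
    rewrite (_ : (6 * k.+1 <= n)%N); last by lia.
    by rewrite (_ : (n.+1 - (6 * k + 7) = n - 6 * k.+1)%N) //; lia.
  case: (leqP (6 * k.+1) n) => hk'; last by rewrite mulr0.
  by rewrite (_ : (n - 6 * k.+1 = 0)%N) ?cluster_sum0 ?mulr0 //; lia.
have -> : SP = \sum_(k < n.+1 | (6 * k + 6 <= n.+1)%N)
        phi (\det (Pmx k.+1)) * y ^+ (3 * k + 2)
          * (cluster_sum (n.+1 - (6 * k + 4)) + y * cluster_sum (n.+1 - (6 * k + 5))).
  rewrite [RHS]big_mkcond; apply: eq_bigr => k _; rewrite delay_add det_Pmx -/cat2 -/cat1 -/(pdet k) /delay.
  case: (leqP (6 * k + 6) n.+1) => hk.
    rewrite (_ : (4 + 6 * k <= n)%N); last by lia.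
    rewrite (_ : (n.+1 - (6 * k + 4) = (n - (4 + 6 * k)).+1)%N); last by lia.
    rewrite (_ : (n.+1 - (6 * k + 5) = n - (4 + 6 * k))%N); last by lia.
    by rewrite cluster_sum_rec; [rewrite exprD; ring | lia].
  case: (leqP (4 + 6 * k) n) => hk'; last by rewrite !mulr0.
  by rewrite (_ : (n - (4 + 6 * k) = 0)%N) ?below_sum0 ?mulr0 //; lia.
ring.
Qed.
End Series.

(** * Conclusion *)

(** Both sides satisfy the same recurrence, whose right-hand side at n only
    uses the indices from 1 to n - 1. *)
Lemma U_specE (U : nat -> {poly rat}) n : U_spec U ->
  (U n)%:P = if n is 0 then 1 else - yvar * cluster_sum yvar n.
Proof.
case=> U0 U1 Urec; elim/ltn_ind: n => -[|[|n]] IH.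
- by rewrite U0.
- by rewrite U1 cluster_sum1 mulr1 rmorphN.
pose phi : {rmorphism rat -> {poly {poly rat}}} := polyC \o polyC.
have IHd d : (0 < d)%N -> (d < n.+2)%N -> (U (n.+2 - d)%N)%:P = - yvar * cluster_sum yvar (n.+2 - d).
  move=> d0 lt_d; have lt_n : (n.+2 - d < n.+2)%N by lia.
  by rewrite IH // (_ : n.+2 - d = (n.+2 - d).-1.+1)%N //; lia.
rewrite Urec // /U_rec rmorphB rmorphD rmorphM rmorphB rmorph1 !rmorph_sum /= IHd // -/yvar.
rewrite (cluster_sum_detE yvar phi (isT : 1 < n.+2)%N).
rewrite (eq_bigr (fun k : 'I_n.+2 => - yvar * (phi (\det (Mmx k.+1)) * yvar ^+ (3 * k + 3)
    * cluster_sum yvar (n.+2 - (6 * k + 7))))) => [|k hk]; last first.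
  by rewrite /= !rmorphM rmorphXn /= IHd ?addnS // -/yvar; [ring|lia].
rewrite [X in _ - X](eq_bigr (fun k : 'I_n.+2 => - yvar * (phi (\det (Pmx k.+1))
    * yvar ^+ (3 * k + 2)
    * (cluster_sum yvar (n.+2 - (6 * k + 4)) + yvar * cluster_sum yvar (n.+2 - (6 * k + 5)))))) => [|k hk]; last first.
  rewrite /= !(rmorphM, rmorphD) rmorphXn /= !IHd ?addnS // -/yvar; try lia.
  by ring.
by rewrite -!mulr_sumr; ring.
Qed.

Definition NM1 : nat -> Qxy := egf (permsum (lrmin_wt yvar 1)).
Definition minS : nat -> Qxy := egf (permsum (min_wt yvar)).

Lemma permsum_lrmin_wt1 n : permsum (lrmin_wt yvar 1) n
  = if n is 0 then 1 else yvar * permsum (avoid_wt yvar) n.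
Proof.
case: n => [|n]; first by rewrite permsum_nil.
rewrite /permsum mulr_sumr big_seq [RHS]big_seq; apply: eq_bigr => w.
rewrite mem_permutations => /perm_size; rewrite size_iota => szw.
by rewrite /lrmin_wt /nilp szw expr1n mul1r.
Qed.

Theorem theorem3 (U : nat -> {poly rat}) (hU : U_spec U) (n : nat) :
  NM [:: 1; 4; 2; 5; 3; 6]%N n
  = fps_rpow (fps_inv (egf (fun m => (U m)%:P))) xvar n.
Proof.
set V := egf _.
have V0 : V 0%N = 1 by rewrite /V /egf (U_specE 0 hU) divr1.
have VF : fps_mul V NM1 = fps_one _.
  rewrite /V /NM1 (egf_mul Qxy_natr_unit); apply: functional_extensionality => m.
  rewrite /egf; case: m => [|m].
    by rewrite big_ord1 bin0 mul1r (U_specE 0 hU) permsum_lrmin_wt1 mulr1 divr1.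
  rewrite [X in X / _](_ : _ = 0) ?mul0r //.
  rewrite -(big_mkord xpredT (fun k => 'C(m.+1, k)%:R * ((U k)%:P * permsum (lrmin_wt yvar 1) (m.+1 - k)%N))).
  rewrite big_ltn // big_nat_recr //= bin0 binn !mul1r subn0 subnn !U_specE // !permsum_lrmin_wt1.
  rewrite mulr1 mul1r permsum_avoid_wt.
  rewrite [X in _ + (X + _)](_ : _ = - (yvar * (yvar * \sum_(1 <= k < m.+1)
      'C(m.+1, k)%:R * (cluster_sum yvar k * permsum (avoid_wt yvar) (m.+1 - k))))).
    by ring.
  rewrite !mulr_sumr -sumrN !big_nat; apply: eq_bigr => k /andP[k0 lt_k].
  rewrite permsum_lrmin_wt1 U_specE //; case: k k0 lt_k => // k _ lt_k.
  have [d ->] : exists d, (m.+1 - k.+1 = d.+1)%N by exists (m - k).-1; lia.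
  by ring.
rewrite (fps_inv_eq V0 VF).
have F10 : NM1 0%N = 1 by rewrite /NM1 /egf permsum_lrmin_wt1 divr1.
have dE x : fps_deriv (egf (permsum (lrmin_wt yvar x)))
    = fps_scale x (fps_mul (egf (permsum (lrmin_wt yvar x))) minS).
  rewrite (fps_deriv_egf Qxy_natr_unit) /minS (egf_mul Qxy_natr_unit).
  by apply: functional_extensionality => m; rewrite /egf /fps_scale permsum_lrmin_wt mulrA.
have dF1 : fps_deriv NM1 = fps_mul NM1 minS.
  by rewrite /NM1 dE; apply: functional_extensionality => m; rewrite /fps_scale mul1r.
have invF1 : fps_mul (fps_inv NM1) NM1 = fps_one _.
  by rewrite fps_mulC; apply: functional_extensionality => m; apply: fps_mulV.
have -> : NM [:: 1; 4; 2; 5; 3; 6]%N = egf (permsum (lrmin_wt yvar xvar)).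
  by apply: functional_extensionality => m; rewrite /NM /egf NM_polyE.
suff -> : egf (permsum (lrmin_wt yvar xvar)) = fps_rpow NM1 xvar by [].
apply: (fps_ode_unique Qxy_natr_unit _ (dE xvar)).
  by rewrite /egf permsum_nil divr1 /fps_rpow /fps_exp fps_comp0 /= invr1.
by rewrite (fps_deriv_rpow Qxy_natr_unit) // dF1 [fps_mul (fps_inv NM1) _]fps_mulA invF1 fps_mul1l.
Qed.
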